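(* Let $A$ be a finite-dimensional $\mathbb{Z}$-graded algebra over a field $K$ with a triangular decomposition $(A^-,T,A^+)$. Suppose that $T$ is semisimple. Then $A$ is BGG if and only if $B^-\simeq(B^+)^{\circledast}$ as graded $T$-bimodules (i.e. $B^-_i\simeq(B^+_{-i})^{\circledast}$ as $T$-bimodules for all $i\in\mathbb{Z}$).
   Context: **Triangular decomposition.** A triangular decomposition of $A$ is a triple $(A^-,T,A^+)$ of graded subalgebras such that: (a) multiplication $A^-\otimes_K T\otimes_K A^+\to A$ is an isomorphism of vector spaces; (b) $T$ is concentrated in degree $0$, $A^+$ is supported in degrees $\ge 0$ and $A^-$ in degrees $\le 0$; (c) $A^-_0=K=A^+_0$; (d) $A^+T=TA^+$ and $A^-T=TA^-$; (e) $T$ is split over $K$, i.e. $\operatorname{End}_T(\lambda)=K$ for every simple $T$-module $\lambda$. **Notation.** $\mathcal{G}(A)$ is the category of finitely generated graded left $A$-modules with degree-preserving morphisms. $B^{\pm}=A^{\pm}T$, a graded subalgebra of $A$ and a graded $T$-bimodule; $T$-modules become $B^\pm$-modules via the quotient map $B^\pm\to T$ killing nonzero degrees. $A^{\mathrm{op}}$ is graded by $(A^{\mathrm{op}})_i=A_{-i}$; $M^*=\operatorname{Hom}_K(M,K)$ is a graded left $A^{\mathrm{op}}$-module with $(M^* )_i=(M_i)^*$ (similarly for $T$). For $\lambda\in\operatorname{Irr}\mathcal{G}(T)$ (isomorphism classes of simple objects) put $\overline{\Delta}(\lambda)=A\otimes_{B^+}\lambda$ and $\overline{\nabla}(\lambda)=\bigl(A^{\mathrm{op}}\otimes_{(B^-)^{\mathrm{op}}}\lambda^*\bigr)^*$.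 **Definitions.** $A$ is BGG if $[\overline{\Delta}(\lambda)]=[\overline{\nabla}(\lambda)]$ in the Grothendieck group $\mathrm{K}_0(\mathcal{G}(A))$ for all $\lambda\in\operatorname{Irr}\mathcal{G}(T)$. $(-)^{\circledast}$ is the $K$-linear dual, exchanging left and right modules, with bimodule structure $(sft)(b)=f(tbs)$ for $s,t\in T$, and grading $(M^\circledast)_i=(M_{-i})^*$. *)

(* Defs.v *)
From HB Require Import structures.
From mathcomp Require Import all_boot all_order all_algebra falgebra.

Set Implicit Arguments.
Unset Strict Implicit.
Unset Printing Implicit Defensive.

Import Order.TTheory GRing.Theory Num.Theory.
Local Open Scope ring_scope.

Lemma linfun_linE (K : fieldType) (U V : vectType K) (f : U -> V) :
  linear f -> linfun f =1 f.
Proof.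
move=> fL; pose fl := GRing.isLinear.Build K U V *:%R f fL.
pose F : {linear U -> V} := HB.pack f fl.
by move=> u; rewrite (lfunE F).
Qed.

Definition bilin (K : fieldType) (U V W : vectType K) (b : U -> V -> W) :
  'Hom(U, 'Hom(V, W)) := linfun (fun u => linfun (b u)).

Lemma bilinE (K : fieldType) (U V W : vectType K) (b : U -> V -> W) :
  (forall u, linear (b u)) -> (forall v, linear (b^~ v)) ->
  forall u v, bilin b u v = b u v.
Proof.
move=> bl br u v; rewrite /bilin linfun_linE ?linfun_linE // => k x y.
apply/lfunP=> w; rewrite add_lfunE scale_lfunE !linfun_linE //.
exact: br.
Qed.

(* V is the internal direct sum of the D i; as V is finite-dimensional, it is *)
(* the sum of finitely many of them.                                          *)
Definition is_grading (K : fieldType) (V : vectType K)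
    (D : int -> {vspace V}) : Prop :=
  (forall (s : seq int) (v : int -> V), uniq s -> (forall i, v i \in D i) ->
     \sum_(i <- s) v i = 0 -> forall i, i \in s -> v i = 0)
  /\ exists s : seq int, (\sum_(i <- s) D i)%VS == fullv.

Record grading (K : fieldType) (V : vectType K) := Grading {
  gdeg :> int -> {vspace V};
  gdegP : is_grading gdeg }.

Lemma memv_sum_seq (K : fieldType) (V : vectType K) (D : int -> {vspace V})
    (s : seq int) (v : V) :
  uniq s -> v \in (\sum_(i <- s) D i)%VS ->
  exists2 w : int -> V, forall i, w i \in D i & v = \sum_(i <- s) w i.
Proof.
elim: s v => [|i s IHs] v /=.
  rewrite big_nil memv0 => _ /eqP->; exists (fun=> 0); first by move=> i; exact: mem0v.
  by rewrite big_nil.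
case/andP=> i's us; rewrite big_cons => /memv_addP[x Dx [y /(IHs _ us)[w Dw ->] ->]].
exists (fun j => if j == i then x else w j).
  by move=> j; case: eqP => [->|_].
rewrite big_cons eqxx; congr (_ + _); apply: eq_big_seq => j sj.
by case: eqP => // jE; rewrite -jE sj in i's.
Qed.

Section GradingTheory.
Variables (K : fieldType) (V : vectType K) (g : grading V).
Implicit Types (i j : int) (v : V).

Definition gsupp : seq int := undup (xchoose (proj2 (gdegP g))).

(* the projection V -> V i along the sum of the other components *)
Definition gproj i : 'End(V) :=
  daddv_pi (g i) (\sum_(j <- gsupp | j != i) g j)%VS.

Lemma gsupp_uniq : uniq gsupp. Proof. exact: undup_uniq. Qed.

Lemma gsupp_full : (\sum_(i <- gsupp) g i)%VS = fullv.
Proof.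
apply/eqP; rewrite eqEsubv subvf /=; have /eqP <- := xchooseP (proj2 (gdegP g)).
rewrite /gsupp; set s := xchoose _; elim: s => [|i s IHs] /=.
  by rewrite !big_nil subvv.
rewrite big_cons; case: ifP => si; last by rewrite big_cons addvS.
rewrite subv_add IHs andbT; rewrite -mem_undup in si.
by rewrite (big_rem _ si) /= addvSl.
Qed.

Lemma gdeg_capI i : (g i :&: (\sum_(j <- gsupp | j != i) g j) = 0)%VS.
Proof.
apply/eqP; rewrite -subv0; apply/subvP=> v; rewrite memv_cap memv0.
rewrite -big_filter => /andP[gv /memv_sum_seq[|w gw vE]].
  by rewrite filter_uniq ?gsupp_uniq.
have := proj1 (gdegP g) (i :: [seq j <- gsupp | j != i])
  (fun j => if j == i then - v else w j).
move=> /(_ _ _ _ i); rewrite mem_head /= eqxx => H.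
rewrite -oppr_eq0; apply/eqP/H => //.
- by rewrite mem_filter eqxx /= filter_uniq // gsupp_uniq.
- by move=> j; case: eqP => [->|//]; rewrite memvN.
rewrite big_cons eqxx {1}vE addrC.
rewrite (eq_big_seq w) ?subrr // => j; rewrite mem_filter.
by case: eqP.
Qed.

Lemma gproj_in i v : gproj i v \in g i. Proof. exact: memv_pi. Qed.

Lemma gproj_id i v : v \in g i -> gproj i v = v.
Proof. by move=> gv; rewrite daddv_pi_id ?gdeg_capI. Qed.

Lemma gdeg_out j v : j \notin gsupp -> v \in g j -> v = 0.
Proof.
move=> s'j gv; have: v \in (\sum_(i <- gsupp) g i)%VS by rewrite gsupp_full memvf.
case/memv_sum_seq=> [|w gw vE]; first exact: gsupp_uniq.
have := proj1 (gdegP g) (j :: gsupp) (fun k => if k == j then v else - w k).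
move=> /(_ _ _ _ j); rewrite mem_head eqxx /= => -> //.
- by rewrite s'j gsupp_uniq.
- by move=> k; case: eqP => [->|_]; rewrite ?memvN.
rewrite big_cons eqxx {1}vE -big_split /= big_seq big1 // => k sk.
by case: eqP => [kj|_]; rewrite ?subrr // -kj sk in s'j *.
Qed.

Lemma gproj_dis i j v : i != j -> v \in g j -> gproj i v = 0.
Proof.
move=> ij gv; have gvE : v \in (\sum_(j <- gsupp | j != i) g j)%VS.
  have [sj|s'j] := boolP (j \in gsupp); last by rewrite (gdeg_out s'j gv) mem0v.
  rewrite (big_rem _ sj) /= eq_sym ij.
  by apply: (subvP (addvSl _ _)).
have UVv := subvP (addvSr (g i) _) _ gvE.
have := daddv_pi_add (gdeg_capI i) UVv.
rewrite [X in _ + X]daddv_pi_id ?(capvC _ (g i)) ?gdeg_capI //.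
by move/(canRL (addrK _)); rewrite subrr.
Qed.

Lemma gproj_gdeg i j v : v \in g j -> gproj i v = if i == j then v else 0.
Proof.
by move=> gv; case: eqVneq => [->|ij]; [exact: gproj_id | exact: gproj_dis gv].
Qed.

Lemma sum_gproj v : \sum_(i <- gsupp) gproj i v = v.
Proof.
have: v \in (\sum_(i <- gsupp) g i)%VS by rewrite gsupp_full memvf.
case/memv_sum_seq=> [|w gw ->]; first exact: gsupp_uniq.
apply: eq_big_seq => i si; rewrite linear_sum (big_rem _ si) /=.
rewrite (gproj_id (gw i)) big_seq big1 ?addr0 // => j.
rewrite mem_rem_uniq ?gsupp_uniq // inE => /andP[ji _].
by apply: gproj_dis (gw j); rewrite eq_sym.
Qed.

Lemma gproj_neq0 i v : gproj i v != 0 -> i \in gsupp.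
Proof.
by apply: contraR => s'i; apply/eqP; apply: gdeg_out s'i (gproj_in _ _).
Qed.

Lemma graded_ind (W : vectType K) (f : 'Hom(V, W)) (U : {vspace W}) :
  (forall i v, v \in g i -> f v \in U) -> forall v, f v \in U.
Proof.
move=> fU v; rewrite -(sum_gproj v) linear_sum; apply: memv_suml => i _.
exact: (fU i _ (gproj_in _ _)).
Qed.

Lemma gdeg_gproj i v : (forall j, j != i -> gproj j v = 0) -> v \in g i.
Proof.
move=> vi; rewrite -(sum_gproj v); apply: memv_suml => j _.
by have [->|/vi->] := eqVneq j i; rewrite ?gproj_in ?mem0v.
Qed.
End GradingTheory.

Lemma is_gradingP (K : fieldType) (V : vectType K) (D : int -> {vspace V})
    (p : int -> 'End(V)) :
  (forall i v, p i v \in D i) ->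
  (forall i j v, v \in D j -> p i v = if i == j then v else 0) ->
  (exists s : seq int, forall v, v = \sum_(i <- s) p i v) -> is_grading D.
Proof.
move=> pD pE [s sE]; split=> [r v ur Dv v0 i ri|].
  have := congr1 (p i) v0; rewrite linear0 linear_sum (big_rem _ ri) /=.
  rewrite (pE _ _ _ (Dv i)) eqxx big_seq big1 ?addr0 // => j.
  rewrite mem_rem_uniq // inE => /andP[ji _].
  by rewrite (pE _ _ _ (Dv j)) eq_sym (negPf ji).
exists s; rewrite eqEsubv subvf; apply/subvP=> v _; rewrite (sE v).
elim: s {sE} => [|i s IHs]; first by rewrite !big_nil mem0v.
by rewrite !big_cons memv_add.
Qed.

Section Tensor.
Variables (K : fieldType) (U V : vectType K).

(* U (x) V, in the coordinates given by the chosen bases of U and V *)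
Definition tensor : vectType K := 'M[K]_(\dim {:U}, \dim {:V}).

Definition tens (u : U) (v : V) : tensor :=
  \matrix_(i, j) (coord (vbasis {:U}) i u * coord (vbasis {:V}) j v).

(* the linear map U (x) V -> W induced by a bilinear map U -> V -> W *)
Definition tlift (W : vectType K) (b : U -> V -> W) : 'Hom(tensor, W) :=
  linfun (fun x : tensor =>
    \sum_i \sum_j (x : 'M_(_, _)) i j *: b (vbasis {:U})`_i (vbasis {:V})`_j).

Lemma tens_linl v : linear (tens^~ v).
Proof.
by move=> k x y; apply/matrixP=> i j; rewrite !mxE linearP mulrDl mulrA.
Qed.

Lemma tens_linr u : linear (tens u).
Proof.
move=> k x y; apply/matrixP=> i j; rewrite !mxE linearP mulrDr.
by rewrite mulrCA.
Qed.

Lemma tens0l v : tens 0 v = 0.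
Proof. by apply/matrixP=> i j; rewrite !mxE linear0 mul0r. Qed.

Lemma tens0r u : tens u 0 = 0.
Proof. by apply/matrixP=> i j; rewrite !mxE linear0 mulr0. Qed.

Lemma tlift_lin (W : vectType K) (b : U -> V -> W) :
  linear (fun x : tensor =>
    \sum_i \sum_j (x : 'M_(_, _)) i j *: b (vbasis {:U})`_i (vbasis {:V})`_j).
Proof.
move=> k x y; rewrite scaler_sumr -big_split; apply: eq_bigr => i _ /=.
rewrite scaler_sumr -big_split; apply: eq_bigr => j _ /=.
by rewrite !mxE scalerDl scalerA.
Qed.

Lemma tliftE (W : vectType K) (b : U -> V -> W) :
  (forall u, linear (b u)) -> (forall v, linear (b^~ v)) ->
  forall u v, tlift b (tens u v) = b u v.
Proof.
move=> bl br u v; rewrite /tlift linfun_linE; last exact: tlift_lin.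
rewrite -[RHS](bilinE bl br) [in RHS](coord_vbasis (memvf u)).
rewrite linear_sum sum_lfunE; apply: eq_bigr => i _.
rewrite [in RHS](coord_vbasis (memvf v)) linear_sum; apply: eq_bigr => j _ /=.
by rewrite linearZ /= linearZ /= scale_lfunE bilinE // mxE scalerA mulrC.
Qed.

Lemma tensor_sum (x : tensor) :
  x = \sum_i \sum_j (x : 'M_(_, _)) i j *: tens (vbasis {:U})`_i (vbasis {:V})`_j.
Proof.
have fU := basis_free (vbasisP {:U}); have fV := basis_free (vbasisP {:V}).
apply/matrixP=> a b; rewrite summxE (bigD1 a) //= summxE (bigD1 b) //=.
rewrite !mxE !coord_free // !eqxx !mulr1 big1 => [|j jb].
  rewrite addr0 big1 ?addr0 // => i ia; rewrite summxE big1 // => j _.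
  by rewrite !mxE !coord_free // (negPf ia) mul0r mulr0.
by rewrite !mxE !coord_free // (negPf jb) !mulr0.
Qed.

Lemma tensor_ind (W : vectType K) (f : 'Hom(tensor, W)) (X : {vspace W}) :
  (forall u v, f (tens u v) \in X) -> forall x, f x \in X.
Proof.
move=> fX x; rewrite (tensor_sum x) linear_sum; apply: memv_suml => i _ /=.
rewrite linear_sum; apply: memv_suml => j _ /=; rewrite linearZ.
exact: memvZ (fX _ _).
Qed.

Lemma tensor_ext (W : vectType K) (f h : 'Hom(tensor, W)) :
  (forall u v, f (tens u v) = h (tens u v)) -> f =1 h.
Proof.
move=> fh x; apply/eqP; rewrite -subr_eq0 -memv0.
have := @tensor_ind _ (f - h) 0%VS.
move=> /(_ _ x); rewrite add_lfunE opp_lfunE; apply=> u v.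
by rewrite add_lfunE opp_lfunE fh subrr mem0v.
Qed.

End Tensor.

Section Quotient.
Variables (K : fieldType) (W : vectType K) (R : {vspace W}).

(* W / R, realised on a complement of R *)
Definition quot : vectType K := subvs_of (R^C)%VS.

Definition qproj : 'Hom(W, quot) :=
  (linfun (vsproj (R^C)%VS) \o (\1 - projv R))%VF.

Definition qlift (X : vectType K) (f : 'Hom(W, X)) : 'Hom(quot, X) :=
  (f \o linfun vsval)%VF.

Lemma vsval_qproj w : vsval (qproj w) = w - projv R w.
Proof.
rewrite /qproj comp_lfunE lfunE add_lfunE opp_lfunE id_lfunE.
by rewrite /= vsprojK ?memv_projC.
Qed.

Lemma qprojK (q : quot) : qproj (vsval q) = q.
Proof.
apply: val_inj; rewrite [LHS]vsval_qproj.
have : vsval q \in lker (projv R) by rewrite lker_proj subvsP.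
by rewrite memv_ker => /eqP->; rewrite subr0.
Qed.

Lemma qproj_eq0 w : w \in R -> qproj w = 0.
Proof.
by move=> Rw; apply: val_inj; rewrite [LHS]vsval_qproj projv_id ?subrr.
Qed.

Lemma qliftE (X : vectType K) (f : 'Hom(W, X)) :
  (forall r, r \in R -> f r = 0) -> forall w, qlift f (qproj w) = f w.
Proof.
move=> fR w; rewrite /qlift comp_lfunE lfunE /= vsval_qproj linearB /=.
by rewrite (fR (projv R w)) ?memv_proj ?subr0.
Qed.

Lemma qlift_ext (X : vectType K) (f h : 'Hom(quot, X)) :
  (forall w, f (qproj w) = h (qproj w)) -> f = h.
Proof. by move=> fh; apply/lfunP=> q; rewrite -(qprojK q). Qed.
End Quotient.

Record galg (K : fieldType) := GAlg {
  galg_alg :> falgType K;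
  ggr : grading galg_alg;
  ggr1 : 1 \in ggr 0;
  ggrM : forall i j a b, a \in ggr i -> b \in ggr j -> a * b \in ggr (i + j) }.

Record ghom (K : fieldType) (S A : galg K) := GHom {
  ghom_fun :> 'Hom(S, A);
  ghom1 : ghom_fun 1 = 1;
  ghomM : forall a b, ghom_fun (a * b) = ghom_fun a * ghom_fun b;
  ghom_gr : forall i a, a \in ggr S i -> ghom_fun a \in ggr A i }.

Section OppositeAlgebra.
Variables (K : fieldType) (A : falgType K).

HB.instance Definition _ := GRing.Zmodule_isLmodule.Build K A^c
  (@scalerA K A) (@scale1r K A) (@scalerDr K A) (@scalerDl K A).

Fact op_scaleAl (k : K) (x y : A^c) : k *: (x * y) = (k *: x) * y.
Proof. exact: (@scalerAr K A k y x). Qed.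
HB.instance Definition _ := GRing.Lmodule_isLalgebra.Build K A^c op_scaleAl.

Fact op_scaleAr (k : K) (x y : A^c) : k *: (x * y) = x * (k *: y).
Proof. exact: (@scalerAl K A k y x). Qed.
HB.instance Definition _ := GRing.Lalgebra_isAlgebra.Build K A^c op_scaleAr.

Fact op_vector_axiom : vector_axiom_def (\dim {:A}) A^c.
Proof.
exists (passmx.rVof (vbasis {:A}) : A^c -> _).
  by move=> k u v; exact: (@passmx.rVof_linear K A (vbasis {:A}) k u v).
exists (passmx.vecof (vbasis {:A}) : _ -> A^c).
  exact/(passmx.rVofK (vbasisP _)).
exact/(passmx.vecofK (vbasisP _)).
Qed.
HB.instance Definition _ := Lmodule_hasFinDim.Build K A^c op_vector_axiom.

Definition to_op : 'Hom(A, A^c) := linfun (fun a : A => a : A^c).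
Definition of_op : 'Hom(A^c, A) := linfun (fun a : A^c => a : A).

Lemma to_opE (a : A) : to_op a = a. Proof. by rewrite linfun_linE. Qed.
Lemma of_opE (a : A^c) : of_op a = a. Proof. by rewrite linfun_linE. Qed.
End OppositeAlgebra.

Section GAlg.
Variables (K : fieldType).
Implicit Types (A S : galg K).

(* (A^op)_i = A_{-i} *)
Definition op_deg A (i : int) : {vspace A^c} :=
  (of_op A @^-1: ggr A (- i))%VS.

Lemma op_degE A i (a : A^c) : (a \in op_deg A i) = ((a : A) \in ggr A (- i)).
Proof. by rewrite -memv_preim of_opE. Qed.

Fact op_is_grading A : is_grading (op_deg A).
Proof.
pose p i := (to_op A \o gproj (ggr A) (- i) \o of_op A)%VF.
have pE i a : p i a = gproj (ggr A) (- i) a.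
  by rewrite !comp_lfunE to_opE of_opE.
apply: (is_gradingP (p := p)) => [i a|i j a|].
- by rewrite op_degE pE gproj_in.
- by rewrite op_degE pE => /gproj_gdeg->; rewrite eqr_opp.
exists (map -%R (gsupp (ggr A))) => a; rewrite big_map.
rewrite -[LHS](sum_gproj (ggr A)); apply: eq_bigr => i _.
by rewrite pE opprK.
Qed.

Fact op_gr1 A : (1 : A^c) \in op_deg A 0.
Proof. by rewrite op_degE oppr0; apply: ggr1. Qed.

Fact op_grM A i j (a b : A^c) :
  a \in op_deg A i -> b \in op_deg A j -> a * b \in op_deg A (i + j).
Proof.
rewrite !op_degE opprD addrC => ai bj.
exact: (ggrM bj ai).
Qed.

Definition gop A : galg K :=
  @GAlg K A^c (Grading (op_is_grading A)) (op_gr1 A) (@op_grM A).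

Section OppositeHom.
Variables (S A : galg K) (f : ghom S A).

Definition gop_fun : 'Hom(gop S, gop A) := (to_op A \o f \o of_op S)%VF.

Lemma gop_funE (s : S) : gop_fun s = f s.
Proof. by rewrite !comp_lfunE to_opE of_opE. Qed.

Fact gop_fun1 : gop_fun 1 = 1.
Proof. by rewrite gop_funE; exact: (ghom1 f). Qed.

Fact gop_funM (a b : gop S) : gop_fun (a * b) = gop_fun a * gop_fun b.
Proof. by rewrite !gop_funE; apply: (ghomM f). Qed.

Fact gop_fun_gr i (a : gop S) :
  a \in ggr (gop S) i -> gop_fun a \in ggr (gop A) i.
Proof. by rewrite gop_funE /= !op_degE; apply: ghom_gr. Qed.

Definition gop_hom : ghom (gop S) (gop A) :=
  GHom gop_fun1 gop_funM gop_fun_gr.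
End OppositeHom.

(* A is (A^op)^op *)
Section OppositeOpposite.
Variable A : galg K.

Definition gopop_fun : 'Hom(A, gop (gop A)) := (to_op (gop A) \o to_op A)%VF.

Lemma gopop_funE (a : A) : gopop_fun a = a.
Proof. by rewrite comp_lfunE !to_opE. Qed.

Fact gopop_fun1 : gopop_fun 1 = 1. Proof. by rewrite gopop_funE. Qed.

Fact gopop_funM (a b : A) : gopop_fun (a * b) = gopop_fun a * gopop_fun b.
Proof. by rewrite !gopop_funE. Qed.

Fact gopop_fun_gr i (a : A) :
  a \in ggr A i -> gopop_fun a \in ggr (gop (gop A)) i.
Proof.
move=> ai; change (gopop_fun a \in op_deg (gop A) i); rewrite op_degE gopop_funE.
by change ((a : A^c) \in op_deg A (- i)); rewrite op_degE opprK.
Qed.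

Definition gopop : ghom A (gop (gop A)) :=
  GHom gopop_fun1 gopop_funM gopop_fun_gr.
End OppositeOpposite.
(* An {aspace A} may have a unit other than 1, hence gsub1. *)
Record gsub A := GSub {
  gsub_asp :> {aspace A};
  gsub1 : 1 \in gsub_asp;
  gsub_proj : forall i a, a \in gsub_asp -> gproj (ggr A) i a \in gsub_asp }.

Section Sub.
Variables (A : galg K) (U : gsub A).

Definition sub_deg (i : int) : {vspace subvs_of U} :=
  (linfun vsval @^-1: ggr A i)%VS.

Lemma sub_degE i (u : subvs_of U) : (u \in sub_deg i) = (vsval u \in ggr A i).
Proof. by rewrite -memv_preim lfunE. Qed.

Fact sub_is_grading : is_grading sub_deg.
Proof.
pose p i : 'End(subvs_of U) :=
  (linfun (vsproj U) \o gproj (ggr A) i \o linfun vsval)%VF.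
have pE i u : vsval (p i u) = gproj (ggr A) i (vsval u).
  rewrite !comp_lfunE !lfunE /= vsprojK //.
  exact: gsub_proj (subvsP u).
apply: (is_gradingP (p := p)) => [i u|i j u|].
- by rewrite sub_degE pE gproj_in.
- rewrite sub_degE => uj; apply: val_inj; rewrite [LHS]pE (gproj_gdeg _ uj).
  by case: ifP.
exists (gsupp (ggr A)) => u; apply: val_inj.
rewrite /= -[LHS](sum_gproj (ggr A)) linear_sum.
by apply: eq_bigr => i _; rewrite /= pE.
Qed.

Lemma vsval1 : vsval (1 : subvs_of U) = 1.
Proof. by apply/eqP; rewrite -[vsval 1]/(algid U) algid_eq1 gsub1. Qed.

Fact sub_gr1 : (1 : subvs_of U) \in sub_deg 0.
Proof. by rewrite sub_degE vsval1 ggr1. Qed.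

Fact sub_grM i j (a b : subvs_of U) :
  a \in sub_deg i -> b \in sub_deg j -> a * b \in sub_deg (i + j).
Proof. by rewrite !sub_degE; apply: ggrM. Qed.

Definition sub_galg : galg K :=
  @GAlg K (subvs_of U) (Grading sub_is_grading) sub_gr1 sub_grM.

Definition sub_fun : 'Hom(sub_galg, A) := linfun vsval.

Lemma sub_funE (u : sub_galg) : sub_fun u = vsval u.
Proof. exact: lfunE. Qed.

Fact sub_fun1 : sub_fun 1 = 1.
Proof. by rewrite sub_funE vsval1. Qed.

Fact sub_funM (a b : sub_galg) : sub_fun (a * b) = sub_fun a * sub_fun b.
Proof. by rewrite !sub_funE. Qed.

Fact sub_fun_gr i (a : sub_galg) : a \in ggr sub_galg i -> sub_fun a \in ggr A i.
Proof. by rewrite sub_funE /= sub_degE. Qed.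

Definition sub_incl : ghom sub_galg A := GHom sub_fun1 sub_funM sub_fun_gr.
End Sub.

Section SubSub.
Variables (A : galg K) (U V : gsub A).
Hypothesis UV : (U <= V)%VS.

Definition subsub_fun : 'Hom(sub_galg U, sub_galg V) :=
  (linfun (vsproj V) \o linfun vsval)%VF.

Lemma subsub_funE (u : sub_galg U) : vsval (subsub_fun u) = vsval u.
Proof. by rewrite comp_lfunE !lfunE /= vsprojK // (subvP UV) ?subvsP. Qed.

Fact subsub_fun1 : subsub_fun 1 = 1.
Proof. by apply: val_inj; rewrite [LHS]subsub_funE [LHS]vsval1 [RHS]vsval1. Qed.

Fact subsub_funM (a b : sub_galg U) :
  subsub_fun (a * b) = subsub_fun a * subsub_fun b.
Proof. by apply: val_inj; rewrite [LHS]subsub_funE /= !subsub_funE. Qed.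

Fact subsub_fun_gr i (a : sub_galg U) :
  a \in ggr (sub_galg U) i -> subsub_fun a \in ggr (sub_galg V) i.
Proof. by rewrite /= !sub_degE subsub_funE. Qed.

Definition sub_subincl : ghom (sub_galg U) (sub_galg V) :=
  GHom subsub_fun1 subsub_funM subsub_fun_gr.
End SubSub.

Lemma gproj_mul0 A i (a t : A) :
  t \in ggr A 0 -> gproj (ggr A) i (a * t) = gproj (ggr A) i a * t.
Proof.
move=> t0; rewrite -{1}(sum_gproj (ggr A) a) mulr_suml linear_sum /=.
have aj j : gproj (ggr A) j a * t \in ggr A j.
  by rewrite -[j in ggr A j]addr0; apply: ggrM (gproj_in _ _ _) t0.
under eq_bigr => j _ do rewrite (gproj_gdeg i (aj j)).
rewrite -big_mkcond /= -big_filter.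
have [si|s'i] := boolP (i \in gsupp (ggr A)).
  rewrite (eq_filter (a2 := pred1 i)); last by move=> j /=; rewrite eq_sym.
  by rewrite filter_pred1_uniq ?gsupp_uniq // big_seq1.
rewrite big_seq big1 => [|j]; last first.
  by rewrite mem_filter => /andP[/eqP<- si]; rewrite si in s'i.
by rewrite (gdeg_out s'i (gproj_in _ _ _)) mul0r.
Qed.

Lemma gproj0_mul A (a b : A) :
  (forall i, i != 0 ->
     gproj (ggr A) i a = 0 \/ gproj (ggr A) (- i) b = 0) ->
  gproj (ggr A) 0 (a * b) = gproj (ggr A) 0 a * gproj (ggr A) 0 b.
Proof.
move=> ab0; rewrite -{1}(sum_gproj (ggr A) a) mulr_suml linear_sum /=.
have E j : gproj (ggr A) 0 (gproj (ggr A) j a * b) =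
    gproj (ggr A) j a * gproj (ggr A) (- j) b.
  rewrite -{1}(sum_gproj (ggr A) b) mulr_sumr linear_sum /=.
  have bk k : gproj (ggr A) j a * gproj (ggr A) k b \in ggr A (j + k).
    exact: ggrM (gproj_in _ _ _) (gproj_in _ _ _).
  under eq_bigr => k _ do
    rewrite (gproj_gdeg 0 (bk k)) eq_sym addrC addr_eq0.
  rewrite -big_mkcond /= -big_filter.
  have [sj|s'j] := boolP (- j \in gsupp (ggr A)).
    by rewrite filter_pred1_uniq ?gsupp_uniq // big_seq1.
  rewrite big_seq big1 => [|k]; last first.
    by rewrite mem_filter => /andP[/eqP-> sk]; rewrite sk in s'j.
  by rewrite (gdeg_out s'j (gproj_in _ _ _)) mulr0.
under eq_bigr => j _ do rewrite E.
have [s0|s'0] := boolP (0 \in gsupp (ggr A)).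
  rewrite (big_rem _ s0) /= oppr0 big_seq big1 ?addr0 // => j.
  rewrite mem_rem_uniq ?gsupp_uniq // inE => /andP[j0 _].
  by have [->|->] := ab0 j j0; rewrite ?mul0r ?mulr0.
rewrite (gdeg_out s'0 (gproj_in _ 0 a)) mul0r big_seq big1 // => j sj.
have j0 : j != 0 by apply: contraNneq s'0 => <-.
by have [->|->] := ab0 j j0; rewrite ?mul0r ?mulr0.
Qed.

Section Prod.
Variables (A : galg K) (U T : gsub A).
Hypothesis T0 : (T <= ggr A 0%R)%VS.
Hypothesis UTC : (U * T = T * U)%VS.

Fact prod_is_aspace : is_aspace (U * T)%VS.
Proof.
rewrite /is_aspace has_algid1; last first.
  by rewrite -[1]mulr1 memv_mul ?gsub1.
rewrite -prodvA [(T * (U * T))%VS]prodvA -UTC -[(U * T * T)%VS]prodvA.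
by rewrite prodv_id prodvA prodv_id subvv.
Qed.

Fact prod_gsub1 : 1 \in ASpace prod_is_aspace.
Proof. by rewrite -[1]mulr1 memv_mul ?gsub1. Qed.

Fact prod_gsub_proj i a :
  a \in ASpace prod_is_aspace -> gproj (ggr A) i a \in ASpace prod_is_aspace.
Proof.
move=> aUT; rewrite memv_preim; apply: subvP a aUT.
apply/prodvP=> u t uU tT; rewrite -memv_preim gproj_mul0 ?(subvP T0) //.
by rewrite memv_mul // gsub_proj.
Qed.

Definition prod_gsub : gsub A := GSub prod_gsub1 prod_gsub_proj.

Lemma sub_prod_gsub : (T <= prod_gsub)%VS.
Proof.
apply/subvP=> t tT /=; rewrite -[t]mul1r; apply: memv_mul => //.
exact: gsub1.
Qed.

Definition one_sided (X : {vspace A}) : Prop :=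
  (forall i, i < 0 -> (X :&: ggr A i = 0)%VS) \/
  (forall i, 0 < i -> (X :&: ggr A i = 0)%VS).

Hypothesis Us : one_sided U.
Hypothesis U0 : (U :&: ggr A 0%R = 1)%VS.

Lemma prod_gproj0 (a : A) : a \in prod_gsub -> gproj (ggr A) 0 a \in T.
Proof.
move=> aUT; rewrite memv_preim; apply: subvP a aUT.
apply/prodvP=> u t uU tT; rewrite -memv_preim gproj_mul0 ?(subvP T0) //.
have : gproj (ggr A) 0 u \in (U :&: ggr A 0%R)%VS.
  by rewrite memv_cap gsub_proj ?gproj_in.
by rewrite U0 => /vlineP[k ->]; rewrite -scalerAl mul1r memvZ.
Qed.

Lemma prod_gproj_eq0 i (a : A) :
  (U :&: ggr A i = 0)%VS -> a \in prod_gsub -> gproj (ggr A) i a = 0.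
Proof.
move=> Ui aUT; apply/eqP; rewrite -memv_ker; apply: subvP a aUT.
apply/prodvP=> u t uU tT; rewrite memv_ker gproj_mul0 ?(subvP T0) //.
have : gproj (ggr A) i u \in (U :&: ggr A i)%VS.
  by rewrite memv_cap gsub_proj ?gproj_in.
by rewrite Ui memv0 => /eqP->; rewrite mul0r.
Qed.

(* the quotient map U T -> T killing the nonzero degrees *)
Definition prod_quot_fun : 'Hom(sub_galg prod_gsub, sub_galg T) :=
  (linfun (vsproj T) \o gproj (ggr A) 0 \o linfun vsval)%VF.

Lemma prod_quot_funE (b : sub_galg prod_gsub) :
  vsval (prod_quot_fun b) = gproj (ggr A) 0 (vsval b).
Proof. by rewrite !comp_lfunE !lfunE /= vsprojK // prod_gproj0 ?subvsP. Qed.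

Fact prod_quot_fun1 : prod_quot_fun 1 = 1.
Proof.
apply: val_inj.
by rewrite [LHS]prod_quot_funE [RHS]vsval1 vsval1 gproj_id ?ggr1.
Qed.

Fact prod_quot_funM (a b : sub_galg prod_gsub) :
  prod_quot_fun (a * b) = prod_quot_fun a * prod_quot_fun b.
Proof.
apply: val_inj; rewrite [LHS]prod_quot_funE /= !prod_quot_funE.
apply: gproj0_mul => i i0; have aP := subvsP a; have bP := subvsP b.
case: (ltgtP i 0) i0 => // i0 _; case: Us => Us'.
- by left; apply: prod_gproj_eq0 aP; apply: Us'.
- by right; apply: prod_gproj_eq0 bP; apply: Us'; rewrite oppr_gt0.
- by right; apply: prod_gproj_eq0 bP; apply: Us'; rewrite oppr_lt0.
by left; apply: prod_gproj_eq0 aP; apply: Us'.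
Qed.

Fact prod_quot_fun_gr i (a : sub_galg prod_gsub) :
  a \in ggr (sub_galg prod_gsub) i -> prod_quot_fun a \in ggr (sub_galg T) i.
Proof.
move=> ai; have {}ai : vsval a \in ggr A i by rewrite -sub_degE.
rewrite /= sub_degE prod_quot_funE.
rewrite (gproj_gdeg _ ai); case: eqVneq ai => [<- //|_ _].
exact: mem0v.
Qed.

Definition prod_quot : ghom (sub_galg prod_gsub) (sub_galg T) :=
  GHom prod_quot_fun1 prod_quot_funM prod_quot_fun_gr.
End Prod.
End GAlg.

Record lmod (K : fieldType) (A : falgType K) := LMod {
  lm_space :> vectType K;
  lm_act : 'Hom(A, 'End(lm_space));
  lm_act1 : lm_act 1 = \1%VF;
  lm_actM : forall a b, lm_act (a * b) = (lm_act a \o lm_act b)%VF }.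

Section Modules.
Variables (K : fieldType) (A : falgType K).
Implicit Type M : lmod A.

Definition submod M (U : {vspace M}) : Prop :=
  forall a m, m \in U -> lm_act M a m \in U.

Definition simple_submod M (U : {vspace M}) : Prop :=
  [/\ submod U, U != 0%VS
    & forall X : {vspace M}, submod X -> (X <= U)%VS -> X = 0%VS \/ X = U].

Definition simple_mod M : Prop := @simple_submod M fullv.

Definition semisimple_mod M : Prop :=
  exists s : seq {vspace M},
    [/\ forall U, U \in s -> simple_submod U,
        directv (\sum_(U <- s) U) & (\sum_(U <- s) U)%VS = fullv].

Definition regular_act : 'Hom(A, 'End(A)) := linfun (@amull K A).

Fact regular_act1 : regular_act 1 = \1%VF.
Proof. by rewrite lfunE /= amull1. Qed.

Fact regular_actM a b : regular_act (a * b) = (regular_act a \o regular_act b)%VF.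
Proof. by rewrite !lfunE /= amullM. Qed.

Definition regular_mod : lmod A := LMod regular_act1 regular_actM.

Definition semisimple_alg : Prop := semisimple_mod regular_mod.

(* End_A(M) = K for all simple M *)
Definition split_alg : Prop :=
  forall M, simple_mod M -> forall f : 'End(M),
    (forall a m, f (lm_act M a m) = lm_act M a (f m)) ->
  exists k : K, f = k *: \1%VF.
End Modules.

(* As A is finite-dimensional, the finitely generated graded A-modules are    *)
(* the finite-dimensional ones.                                               *)
Record gmod (K : fieldType) (A : galg K) := GMod {
  gm_mod :> lmod A;
  gm_gr : grading gm_mod;
  gm_actP : forall i j a m, a \in ggr A i -> m \in gm_gr j ->
    lm_act gm_mod a m \in gm_gr (i + j) }.

Section GradedModules.
Variables (K : fieldType) (A : galg K).
Implicit Types M N : gmod A.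

Definition gmod_hom M N (f : 'Hom(M, N)) : Prop :=
  (forall a m, f (lm_act M a m) = lm_act N a (f m)) /\
  (forall i m, m \in gm_gr M i -> f m \in gm_gr N i).

Definition short_exact M1 M2 M3 (f : 'Hom(M1, M2)) (h : 'Hom(M2, M3)) : Prop :=
  [/\ gmod_hom f, gmod_hom h, lker f = 0%VS, limg f = lker h & limg h = fullv].

Definition gsimple M : Prop :=
  (fullv : {vspace M}) != 0%VS /\
  forall U : {vspace M}, submod U ->
    (forall i m, m \in U -> gproj (gm_gr M) i m \in U) ->
  U = 0%VS \/ U = fullv.

(* The Grothendieck group: formal Z-combinations of objects, up to the        *)
(* congruence generated by the abelian group laws and short exact sequences.  *)
Inductive K0 :=
  | K0class of gmod A
  | K0zero
  | K0opp of K0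
  | K0add of K0 & K0.

Inductive K0eq : K0 -> K0 -> Prop :=
  | K0eq_refl x : K0eq x x
  | K0eq_sym x y : K0eq x y -> K0eq y x
  | K0eq_trans x y z : K0eq x y -> K0eq y z -> K0eq x z
  | K0eq_opp x y : K0eq x y -> K0eq (K0opp x) (K0opp y)
  | K0eq_add x x' y y' :
      K0eq x x' -> K0eq y y' -> K0eq (K0add x y) (K0add x' y')
  | K0eq_addA x y z : K0eq (K0add x (K0add y z)) (K0add (K0add x y) z)
  | K0eq_addC x y : K0eq (K0add x y) (K0add y x)
  | K0eq_add0 x : K0eq (K0add K0zero x) x
  | K0eq_addN x : K0eq (K0add (K0opp x) x) K0zero
  | K0eq_exact M1 M2 M3 (f : 'Hom(M1, M2)) (h : 'Hom(M2, M3)) :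
      short_exact f h ->
      K0eq (K0class M2) (K0add (K0class M1) (K0class M3)).
End GradedModules.

Section Restriction.
Variables (K : fieldType) (S A : galg K) (f : ghom S A) (M : gmod A).

Definition res_act : 'Hom(S, 'End(M)) := (lm_act M \o f)%VF.

Lemma res_actE s : res_act s = lm_act M (f s).
Proof. by rewrite comp_lfunE. Qed.

Fact res_act1 : res_act 1 = \1%VF.
Proof. by rewrite res_actE ghom1 lm_act1. Qed.

Fact res_actM a b : res_act (a * b) = (res_act a \o res_act b)%VF.
Proof. by rewrite !res_actE ghomM lm_actM. Qed.

Definition res_mod : lmod S := LMod res_act1 res_actM.

Fact res_actP i j a (m : res_mod) :
  a \in ggr S i -> m \in gm_gr M j -> lm_act res_mod a m \in gm_gr M (i + j).
Proof.
move=> ai mj; rewrite [lm_act _ a]res_actE.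
by apply: gm_actP => //; apply: ghom_gr.
Qed.

Definition gres : gmod S := @GMod K S res_mod (gm_gr M) res_actP.
End Restriction.

(* The dual M^* of a left A-module: (a f)(m) = f (a m), and (M^* )_i consists *)
(* of the functionals f with f = f \o (projection on M_i), i.e. is (M_i)^*.   *)
Section Dual.
Variables (K : fieldType).

Definition vdual (V : vectType K) : vectType K := 'Hom(V, K^o).

Definition dual_deg (V : vectType K) (g : grading V) (i : int) :
    {vspace vdual V} :=
  lker (linfun (fun f : vdual V => f - (f \o gproj g i)%VF)).

Lemma dual_deg_lin (V : vectType K) (h : 'End(V)) :
  linear (fun f : vdual V => (f \o h)%VF : vdual V).
Proof. by move=> k x y; rewrite comp_lfunDl comp_lfunZl. Qed.

Lemma dual_degP (V : vectType K) (g : grading V) i (f : vdual V) :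
  reflect (f = (f \o gproj g i)%VF) (f \in dual_deg g i).
Proof.
rewrite memv_ker linfun_linE; first by rewrite subr_eq0; apply: eqP.
by move=> k x y; rewrite dual_deg_lin scalerBr opprD addrACA.
Qed.

Lemma dual_degE (V : vectType K) (g : grading V) i (f : vdual V) :
  f \in dual_deg g i <-> forall j v, j != i -> v \in g j -> f v = 0.
Proof.
split=> [/dual_degP fE j v ji vj|fi].
  by rewrite fE comp_lfunE (gproj_dis _ vj) ?linear0 // eq_sym.
apply/dual_degP/lfunP=> v; rewrite comp_lfunE.
rewrite -{1}(sum_gproj g v) linear_sum.
have [si|s'i] := boolP (i \in gsupp g).
  rewrite (big_rem _ si) /= big_seq big1 ?addr0 // => j.
  rewrite mem_rem_uniq ?gsupp_uniq // inE => /andP[ji _].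
  exact: fi ji (gproj_in _ _ _).
rewrite (gdeg_out s'i (gproj_in _ _ v)) linear0 big_seq big1 // => j sj.
by apply: fi (gproj_in _ _ _); apply: contraNneq s'i => <-.
Qed.

Fact dual_is_grading (V : vectType K) (g : grading V) :
  is_grading (dual_deg g).
Proof.
pose p i : 'End(vdual V) := linfun (fun f : vdual V => (f \o gproj g i)%VF : vdual V).
have pE i f : p i f = (f \o gproj g i)%VF.
  by rewrite linfun_linE //; apply: dual_deg_lin.
have pp i j : (gproj g i \o gproj g j)%VF = if i == j then gproj g j else 0.
  apply/lfunP=> v; rewrite comp_lfunE (gproj_gdeg i (gproj_in g j v)).
  by case: ifP => _ //; rewrite zero_lfunE.
apply: (is_gradingP (p := p)) => [i f|i j f|].
- by apply/dual_degP; rewrite pE -comp_lfunA pp eqxx.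
- move=> /dual_degP fE; rewrite pE fE -comp_lfunA pp [j == i]eq_sym.
  by case: eqP => [->|_] //; rewrite comp_lfun0r.
exists (gsupp g) => f; apply/lfunP=> v; rewrite sum_lfunE.
rewrite -{1}(sum_gproj g v) linear_sum; apply: eq_bigr => i _ /=.
by rewrite pE comp_lfunE.
Qed.

Variables (A : galg K) (M : gmod A).

Definition dual_act : 'Hom(gop A, 'End(vdual M)) :=
  bilin (fun (a : A^c) (f : vdual M) => (f \o lm_act M (a : A))%VF : vdual M).

Lemma dual_actE (a : A) (f : vdual M) : dual_act a f = (f \o lm_act M a)%VF.
Proof.
rewrite /dual_act bilinE // => [b|h k x y]; first exact: dual_deg_lin.
rewrite comp_lfunZr -comp_lfunDr; congr (_ \o _)%VF.
exact: (linearP (lm_act M) k (x : A) (y : A)).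
Qed.

Fact dual_act1 : dual_act 1 = \1%VF.
Proof.
apply/lfunP=> f; rewrite dual_actE id_lfunE -[RHS]comp_lfun1r.
congr (_ \o _)%VF; exact: (lm_act1 M).
Qed.

Fact dual_actM (a b : gop A) : dual_act (a * b) = (dual_act a \o dual_act b)%VF.
Proof.
apply/lfunP=> f; rewrite [RHS]comp_lfunE !dual_actE -comp_lfunA.
congr (_ \o _)%VF; exact: (lm_actM M).
Qed.

Definition dual_mod : lmod (gop A) := LMod dual_act1 dual_actM.

Fact dual_actP i j a (f : dual_mod) :
  a \in ggr (gop A) i -> f \in dual_deg (gm_gr M) j ->
  lm_act dual_mod a f \in dual_deg (gm_gr M) (i + j).
Proof.
move=> ai /dual_degE fj; apply/dual_degE => k v kij vk.
rewrite [lm_act _ a f]dual_actE comp_lfunE.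
have {}ai : (a : A) \in ggr A (- i) by rewrite -op_degE.
apply: fj (gm_actP ai vk); apply: contraNneq kij => <-.
by rewrite addNKr.
Qed.

Definition gdual : gmod (gop A) :=
  @GMod K (gop A) dual_mod (Grading (dual_is_grading (gm_gr M))) dual_actP.
End Dual.

(* induction along f : S -> A, i.e. the A-module A (x)_S V *)
Section Induction.
Variables (K : fieldType).

Lemma tlift_linear (Z U V W : vectType K) (b : Z -> U -> V -> W) :
  (forall u v, linear (fun z => b z u v)) ->
  forall x, linear (fun z => tlift (b z) x).
Proof.
move=> bl x k y z; rewrite /tlift !linfun_linE; do ?exact: tlift_lin.
rewrite scaler_sumr -big_split; apply: eq_bigr => i _ /=.
rewrite scaler_sumr -big_split; apply: eq_bigr => j _ /=.
by rewrite bl scalerDr !scalerA mulrC.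
Qed.

Lemma tensor_gind (U V W : vectType K) (gU : grading U) (gV : grading V)
    (f : 'Hom(tensor U V, W)) (X : {vspace W}) :
  (forall i j u v, u \in gU i -> v \in gV j -> f (tens u v) \in X) ->
  forall x, f x \in X.
Proof.
move=> fX; apply: tensor_ind => u v.
pose fv := (f \o linfun (fun u => tens u v))%VF.
have fvE w : fv w = f (tens w v) by rewrite comp_lfunE linfun_linE //; apply: tens_linl.
rewrite -fvE; apply: (graded_ind (g := gU)) => i w wi; rewrite fvE.
pose fw := (f \o linfun (tens w))%VF.
have fwE y : fw y = f (tens w y) by rewrite comp_lfunE linfun_linE //; apply: tens_linr.
by rewrite -fwE; apply: (graded_ind (g := gV)) => j y yj; rewrite fwE; apply: fX wi yj.
Qed.

Lemma tensor_gext (U V W : vectType K) (gU : grading U) (gV : grading V)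
    (f h : 'Hom(tensor U V, W)) :
  (forall i j u v, u \in gU i -> v \in gV j -> f (tens u v) = h (tens u v)) ->
  f =1 h.
Proof.
move=> fh x; apply/eqP; rewrite -subr_eq0 -memv0.
have := @tensor_gind _ _ _ gU gV (f - h) 0%VS.
move=> /(_ _ x); rewrite add_lfunE opp_lfunE; apply=> i j u v ui vj.
by rewrite add_lfunE opp_lfunE (fh i j u v ui vj) subrr mem0v.
Qed.

Variables (S A : galg K) (f : ghom S A) (V : gmod S).

Local Notation AV := (tensor A V).
Local Notation ASV := (tensor A (tensor S V)).
Local Notation gA := (gproj (ggr A)).
Local Notation gV := (gproj (gm_gr V)).

(* A (x)_S V is the cokernel of a (x) s (x) v |-> a f(s) (x) v - a (x) s v *)
Definition ind_rel : 'Hom(ASV, AV) :=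
  tlift (fun a : A => tlift (fun (s : S) (v : V) =>
    tens (a * f s) v - tens a (lm_act V s v))).

Definition ind_space : vectType K := quot (limg ind_rel).

Definition ind_tens (a : A) (v : V) : ind_space :=
  qproj (limg ind_rel) (tens a v).

Definition ind_lmul (a : A) : 'End(AV) :=
  tlift (fun (b : A) (v : V) => tens (a * b) v).

Definition ind_act : 'Hom(A, 'End(ind_space)) :=
  bilin (fun a => qlift (limg ind_rel) (qproj (limg ind_rel) \o ind_lmul a)%VF).

(* the projection of A (x) V on its component of degree i *)
Definition ind_proj (i : int) : 'End(AV) :=
  tlift (fun (a : A) (v : V) =>
    \sum_(j <- gsupp (ggr A)) tens (gA j a) (gV (i - j) v)).

Definition ind_deg (i : int) : {vspace ind_space} :=
  limg (qproj (limg ind_rel) \o ind_proj i)%VF.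

Lemma ind_relE a s v :
  ind_rel (tens a (tens s v)) = tens (a * f s) v - tens a (lm_act V s v).
Proof.
rewrite /ind_rel tliftE => [|b|x]; first last.
- apply: tlift_linear => t w k y z.
  by rewrite mulrDl -scalerAl !tens_linl scalerBr opprD addrACA.
- exact: linearP.
rewrite tliftE // => [t k y z|w k y z].
  by rewrite linearP !tens_linr scalerBr opprD addrACA.
by rewrite !linearP mulrDr -scalerAr add_lfunE scale_lfunE tens_linl tens_linr
           scalerBr opprD addrACA.
Qed.

Lemma ind_lmulE a b v : ind_lmul a (tens b v) = tens (a * b) v.
Proof.
rewrite /ind_lmul tliftE // => [c|w k x y]; first exact: tens_linr.
by rewrite mulrDr -scalerAr tens_linl.
Qed.

Lemma ind_projE i j k a v : a \in ggr A j -> v \in gm_gr V k ->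
  ind_proj i (tens a v) = if i == j + k then tens a v else 0.
Proof.
move=> aj vk; rewrite /ind_proj tliftE => [|b|w]; first last.
- move=> c x y; rewrite scaler_sumr -big_split; apply: eq_bigr => l _ /=.
  by rewrite linearP tens_linl.
- move=> c x y; rewrite scaler_sumr -big_split; apply: eq_bigr => l _ /=.
  by rewrite linearP tens_linr.
have [sj|s'j] := boolP (j \in gsupp (ggr A)); last first.
  rewrite (gdeg_out s'j aj) tens0l if_same big1 // => l _.
  by rewrite linear0 tens0l.
rewrite (big_rem _ sj) /= (gproj_id aj) big_seq big1 ?addr0 => [|l]; last first.
  rewrite mem_rem_uniq ?gsupp_uniq // inE => /andP[lj _].
  by rewrite (gproj_dis lj aj) tens0l.
rewrite (gproj_gdeg _ vk) subr_eq addrC.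
by case: ifP => // _; rewrite tens0r.
Qed.

Lemma ind_rel_lmul a r : r \in limg ind_rel -> ind_lmul a r \in limg ind_rel.
Proof.
case/memv_imgP=> x _ ->; rewrite -comp_lfunE; apply: tensor_ind x => b y.
pose h := (ind_lmul a \o ind_rel \o linfun (fun y : tensor S V => tens b y))%VF.
have hE z : h z = (ind_lmul a \o ind_rel)%VF (tens b z).
  by rewrite [LHS]comp_lfunE (linfun_linE (@tens_linr _ _ _ b)).
rewrite -hE; apply: tensor_ind y => s v.
rewrite hE comp_lfunE ind_relE linearB /= !ind_lmulE mulrA -ind_relE.
exact: memv_img (memvf _).
Qed.

Lemma ind_rel_proj i r : r \in limg ind_rel -> ind_proj i r \in limg ind_rel.
Proof.
case/memv_imgP=> x _ ->; rewrite -comp_lfunE; apply: tensor_ind x => b y.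
pose hb := (ind_proj i \o ind_rel \o linfun (fun b : A => tens b y))%VF.
have hbE z : hb z = (ind_proj i \o ind_rel)%VF (tens z y).
  by rewrite [LHS]comp_lfunE (linfun_linE (@tens_linl _ _ _ y)).
rewrite -hbE; apply: (graded_ind (g := ggr A)) b => j b bj; rewrite hbE; clear hb hbE.
pose h := (ind_proj i \o ind_rel \o linfun (fun y : tensor S V => tens b y))%VF.
have hE z : h z = (ind_proj i \o ind_rel)%VF (tens b z).
  by rewrite [LHS]comp_lfunE (linfun_linE (@tens_linr _ _ _ b)).
rewrite -hE; apply: (tensor_gind (gU := ggr S) (gV := gm_gr V)) y => k l s v sk vl.
rewrite hE comp_lfunE ind_relE linearB /=.
rewrite (ind_projE i (ggrM bj (ghom_gr f sk)) vl).
rewrite (ind_projE i bj (gm_actP sk vl)) -addrA.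
case: ifP => _; last by rewrite subrr mem0v.
by rewrite -ind_relE; exact: memv_img (memvf _).
Qed.

Lemma ind_projK i j w :
  ind_proj i (ind_proj j w) = if i == j then ind_proj j w else 0.
Proof.
rewrite -comp_lfunE.
have -> : (if i == j then ind_proj j w else 0) =
          (if i == j then ind_proj j else 0) w by case: ifP; rewrite ?zero_lfunE.
apply: (tensor_gext (gU := ggr A) (gV := gm_gr V)) w => k l a v ak vl.
rewrite comp_lfunE (ind_projE j ak vl); case: (eqVneq j (k + l)) => [->|jkl].
  rewrite (ind_projE i ak vl); case: eqP => [_ |]; last by rewrite zero_lfunE.
  by rewrite (ind_projE _ ak vl) eqxx.
rewrite linear0; case: eqP => [_|]; last by rewrite zero_lfunE.
by rewrite (ind_projE j ak vl) (negPf jkl).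
Qed.

Fact ind_is_grading : is_grading ind_deg.
Proof.
have [p pE] : exists p : int -> 'End(ind_space), forall i w,
    p i (qproj (limg ind_rel) w) = qproj (limg ind_rel) (ind_proj i w).
  exists (fun i => qlift (limg ind_rel) (qproj (limg ind_rel) \o ind_proj i)%VF).
  move=> i w; rewrite qliftE ?comp_lfunE // => r Rr.
  by rewrite comp_lfunE qproj_eq0 // ind_rel_proj.
apply: (is_gradingP (p := p)) => [i q|i j q|].
- by rewrite -(qprojK q) pE -comp_lfunE memv_img ?memvf.
- case/memv_imgP=> w _ ->; rewrite comp_lfunE pE ind_projK.
  by case: ifP => //; rewrite linear0.
pose s := undup [seq i + j | i <- gsupp (ggr A), j <- gsupp (gm_gr V)].
exists s => q; rewrite -(qprojK q).
under eq_bigr => i _ do rewrite pE.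
rewrite -linear_sum; congr (qproj _ _); move: (vsval q) => w.
rewrite -sum_lfunE -[LHS]id_lfunE.
apply: (tensor_gext (gU := ggr A) (gV := gm_gr V)) w => j k a v aj vk.
rewrite id_lfunE sum_lfunE.
under eq_bigr => i _ do rewrite (ind_projE i aj vk).
have [sj|s'j] := boolP (j \in gsupp (ggr A)); last first.
  by rewrite (gdeg_out s'j aj) tens0l big1 // => i _; rewrite if_same.
have [sk|s'k] := boolP (k \in gsupp (gm_gr V)); last first.
  have v0 : tens a v = 0 by rewrite (gdeg_out s'k vk) tens0r.
  by rewrite v0 big1 // => i _; rewrite if_same.
have sjk : j + k \in s by rewrite mem_undup; apply: allpairs_f.
rewrite (big_rem _ sjk) /= eqxx big_seq big1 ?addr0 // => i.
by rewrite mem_rem_uniq ?undup_uniq // inE => /andP[/negPf->].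
Qed.

Lemma ind_actE a w :
  ind_act a (qproj (limg ind_rel) w) = qproj (limg ind_rel) (ind_lmul a w).
Proof.
have E b z : qlift (limg ind_rel) (qproj (limg ind_rel) \o ind_lmul b)%VF
    (qproj (limg ind_rel) z) = qproj (limg ind_rel) (ind_lmul b z).
  rewrite qliftE ?comp_lfunE // => r Rr.
  by rewrite comp_lfunE qproj_eq0 // ind_rel_lmul.
rewrite /ind_act bilinE // => [b|q k x y]; first exact: linearP.
rewrite -(qprojK q) !E -[RHS](linearP (qproj (limg ind_rel))).
congr (fun_of_lfun _ _); apply: (tlift_linear (b := fun (a b : A) (v : V) => tens (a * b) v)).
move=> b v l u z.
by rewrite mulrDl -scalerAl tens_linl.
Qed.

Lemma ind_tens_balanced a s v :
  ind_tens (a * f s) v = ind_tens a (lm_act V s v).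
Proof.
apply/eqP; rewrite -subr_eq0 -[_ - _](linearB (qproj (limg ind_rel))) -ind_relE.
exact/eqP/qproj_eq0/memv_img/memvf.
Qed.

Lemma ind_act_tens a b v : ind_act a (ind_tens b v) = ind_tens (a * b) v.
Proof. by rewrite /ind_tens ind_actE ind_lmulE. Qed.

Lemma ind_tens_deg j k a v : a \in ggr A j -> v \in gm_gr V k ->
  ind_tens a v \in ind_deg (j + k).
Proof.
move=> aj vk; have tE : ind_proj (j + k) (tens a v) = tens a v.
  by rewrite (ind_projE _ aj vk) eqxx.
by rewrite /ind_tens -tE -comp_lfunE memv_img ?memvf.
Qed.

Fact ind_act1 : ind_act 1 = \1%VF.
Proof.
apply: qlift_ext => w; rewrite ind_actE id_lfunE; congr (qproj _ _).
rewrite -[RHS]id_lfunE; apply: tensor_ext w => a v.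
by rewrite ind_lmulE mul1r id_lfunE.
Qed.

Fact ind_actM a b : ind_act (a * b) = (ind_act a \o ind_act b)%VF.
Proof.
apply: qlift_ext => w; rewrite [RHS]comp_lfunE !ind_actE.
congr (qproj _ _); rewrite -[RHS]comp_lfunE; apply: tensor_ext w => c v.
by rewrite comp_lfunE !ind_lmulE mulrA.
Qed.

Definition ind_mod : lmod A := LMod ind_act1 ind_actM.

Fact ind_actP i j a (q : ind_mod) :
  a \in ggr A i -> q \in ind_deg j -> lm_act ind_mod a q \in ind_deg (i + j).
Proof.
move=> ai /memv_imgP[w _ ->].
rewrite comp_lfunE [lm_act _ a _]ind_actE.
suff -> : ind_lmul a (ind_proj j w) = ind_proj (i + j) (ind_lmul a w).
  by rewrite -comp_lfunE; apply: memv_img (memvf _).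
rewrite -!comp_lfunE.
apply: (tensor_gext (gU := ggr A) (gV := gm_gr V)) w => k l b v bk vl.
rewrite !comp_lfunE (ind_projE j bk vl) ind_lmulE.
rewrite (ind_projE (i + j) (ggrM ai bk) vl) -addrA (inj_eq (addrI i)).
by case: ifP => _; rewrite ?linear0 ?ind_lmulE.
Qed.

Definition gind : gmod A := @GMod K A ind_mod (Grading ind_is_grading) ind_actP.
End Induction.

Record gbimod (K : fieldType) (T : galg K) := GBimod {
  gb_mod :> gmod T;
  gb_ract : 'Hom(T, 'End(gb_mod));
  gb_ract1 : gb_ract 1 = \1%VF;
  gb_ractM : forall s t, gb_ract (s * t) = (gb_ract t \o gb_ract s)%VF;
  gb_comm : forall s t m,
    gb_ract t (lm_act gb_mod s m) = lm_act gb_mod s (gb_ract t m);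
  gb_ractP : forall i j t m, t \in ggr T i -> m \in gm_gr gb_mod j ->
    gb_ract t m \in gm_gr gb_mod (j + i) }.

Definition gbimod_iso (K : fieldType) (T : galg K) (M N : gbimod T) : Prop :=
  exists f : 'Hom(M, N),
    [/\ bijective f, gmod_hom f &
        forall t m, f (gb_ract M t m) = gb_ract N t (f m)].

(* A as a bimodule over itself, restricted along f : T -> A *)
Section RegularBimodule.
Variables (K : fieldType) (T A : galg K) (f : ghom T A).

Fact regular_actP i j a (m : regular_mod A) :
  a \in ggr A i -> m \in ggr A j -> lm_act (regular_mod A) a m \in ggr A (i + j).
Proof. by move=> ai mj; rewrite !lfunE; apply: ggrM. Qed.

Definition gregular_mod : gmod A :=
  @GMod K A (regular_mod A) (ggr A) regular_actP.

Local Notation M := (gres f gregular_mod).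

Lemma hom_lactE (t : T) (a : M) : lm_act M t a = f t * (a : A).
Proof. by rewrite /= comp_lfunE !lfunE. Qed.

Definition hom_ract : 'Hom(T, 'End(M)) := (linfun (@amulr K A) \o f)%VF.

Lemma hom_ractE (t : T) (a : M) : hom_ract t a = (a : A) * f t.
Proof. by rewrite comp_lfunE !lfunE. Qed.

Fact hom_ract1 : hom_ract 1 = \1%VF.
Proof. by apply/lfunP=> a; rewrite hom_ractE ghom1 mulr1 id_lfunE. Qed.

Fact hom_ractM s t : hom_ract (s * t) = (hom_ract t \o hom_ract s)%VF.
Proof. by apply/lfunP=> a; rewrite comp_lfunE !hom_ractE ghomM mulrA. Qed.

Fact hom_comm s t (m : M) :
  hom_ract t (lm_act M s m) = lm_act M s (hom_ract t m).
Proof. by rewrite hom_ractE !hom_lactE hom_ractE mulrA. Qed.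

Fact hom_ractP i j t (m : M) :
  t \in ggr T i -> m \in gm_gr M j -> hom_ract t m \in gm_gr M (j + i).
Proof. by move=> ti mj; rewrite hom_ractE; apply: ggrM mj (ghom_gr f ti). Qed.

Definition hom_bimod : gbimod T :=
  @GBimod K T M hom_ract hom_ract1 hom_ractM hom_comm hom_ractP.
End RegularBimodule.

(* M^⊛ : (s f t)(b) = f (t b s), and (M^⊛)_i = (M_{-i})^* *)
Section BimoduleDual.
Variables (K : fieldType) (T : galg K) (M : gbimod T).

Definition bdual_deg (i : int) : {vspace vdual M} :=
  dual_deg (gm_gr M) (- i).

Fact bdual_is_grading : is_grading bdual_deg.
Proof.
pose g := Grading (dual_is_grading (gm_gr M)).
apply: (is_gradingP (p := fun i => gproj g (- i))) => [i v|i j v vj|].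
- exact: gproj_in.
- by rewrite (gproj_gdeg (g := g) _ vj) eqr_opp.
exists (map -%R (gsupp g)) => v; rewrite big_map -[LHS](sum_gproj g).
by apply: eq_bigr => i _; rewrite opprK.
Qed.

Lemma bdual_lin (h : 'Hom(T, 'End(M))) (f : vdual M) :
  linear (fun s : T => (f \o h s)%VF : vdual M).
Proof. by move=> k x y; rewrite linearP comp_lfunZr -comp_lfunDr. Qed.

Definition bdual_lact : 'Hom(T, 'End(vdual M)) :=
  bilin (fun (s : T) (f : vdual M) => (f \o gb_ract M s)%VF : vdual M).

Definition bdual_ract : 'Hom(T, 'End(vdual M)) :=
  bilin (fun (t : T) (f : vdual M) => (f \o lm_act M t)%VF : vdual M).

Lemma bdual_lactE s f : bdual_lact s f = (f \o gb_ract M s)%VF.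
Proof.
rewrite /bdual_lact bilinE // => [b|h]; first exact: dual_deg_lin.
exact: bdual_lin.
Qed.

Lemma bdual_ractE t f : bdual_ract t f = (f \o lm_act M t)%VF.
Proof.
rewrite /bdual_ract bilinE // => [b|h]; first exact: dual_deg_lin.
exact: bdual_lin.
Qed.

Fact bdual_lact1 : bdual_lact 1 = \1%VF.
Proof.
by apply/lfunP=> f; rewrite bdual_lactE gb_ract1 comp_lfun1r id_lfunE.
Qed.

Fact bdual_lactM s t : bdual_lact (s * t) = (bdual_lact s \o bdual_lact t)%VF.
Proof.
by apply/lfunP=> f; rewrite [RHS]comp_lfunE !bdual_lactE gb_ractM comp_lfunA.
Qed.

Definition bdual_mod : lmod T := LMod bdual_lact1 bdual_lactM.

Fact bdual_lactP i j s (f : bdual_mod) :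
  s \in ggr T i -> f \in bdual_deg j -> lm_act bdual_mod s f \in bdual_deg (i + j).
Proof.
move=> si /dual_degE fj; apply/dual_degE => k v kij vk.
rewrite [lm_act _ s f]bdual_lactE comp_lfunE.
apply: fj (gb_ractP si vk); apply: contraNneq kij => jE.
by rewrite opprD -jE addrC addrK.
Qed.

Definition bdual_gmod : gmod T :=
  @GMod K T bdual_mod (Grading bdual_is_grading) bdual_lactP.

Fact bdual_ract1 : bdual_ract 1 = \1%VF.
Proof.
by apply/lfunP=> f; rewrite bdual_ractE lm_act1 comp_lfun1r id_lfunE.
Qed.

Fact bdual_ractM s t : bdual_ract (s * t) = (bdual_ract t \o bdual_ract s)%VF.
Proof.
by apply/lfunP=> f; rewrite [RHS]comp_lfunE !bdual_ractE lm_actM comp_lfunA.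
Qed.

Fact bdual_comm s t (f : bdual_gmod) :
  bdual_ract t (lm_act bdual_gmod s f) = lm_act bdual_gmod s (bdual_ract t f).
Proof.
rewrite [lm_act _ s f]bdual_lactE [lm_act _ s _]bdual_lactE !bdual_ractE.
by apply/lfunP=> m; rewrite !comp_lfunE gb_comm.
Qed.

Fact bdual_ractP i j t (f : bdual_gmod) :
  t \in ggr T i -> f \in gm_gr bdual_gmod j ->
  bdual_ract t f \in gm_gr bdual_gmod (j + i).
Proof.
move=> ti /dual_degE fj; apply/dual_degE => k v kij vk.
rewrite bdual_ractE comp_lfunE.
apply: fj (gm_actP ti vk); apply: contraNneq kij => jE.
by rewrite opprD -jE addrC addrA addNr add0r.
Qed.

Definition gbdual : gbimod T :=
  @GBimod K T bdual_gmod bdual_ract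
    bdual_ract1 bdual_ractM bdual_comm bdual_ractP.
End BimoduleDual.

Definition mul_map (K : fieldType) (A : galg K) (U T V : gsub A) :
  'Hom(tensor (tensor (sub_galg U) (sub_galg T)) (sub_galg V), A) :=
  tlift (fun x (v : sub_galg V) =>
    tlift (fun (u : sub_galg U) (t : sub_galg T) => sub_incl U u * sub_incl T t) x
    * sub_incl V v).

Record tridec (K : fieldType) (A : galg K) := TriDec {
  td_neg : gsub A;
  td_zero : gsub A;
  td_pos : gsub A;
  td_mul : bijective (mul_map td_neg td_zero td_pos);
  td_zero_deg : (td_zero <= ggr A 0%R)%VS;
  td_pos_deg : forall i, i < 0 -> (td_pos :&: ggr A i = 0)%VS;
  td_neg_deg : forall i, 0 < i -> (td_neg :&: ggr A i = 0)%VS;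
  td_neg0 : (td_neg :&: ggr A 0%R = 1)%VS;
  td_pos0 : (td_pos :&: ggr A 0%R = 1)%VS;
  td_posC : (td_pos * td_zero = td_zero * td_pos)%VS;
  td_negC : (td_neg * td_zero = td_zero * td_neg)%VS;
  td_split : split_alg (sub_galg td_zero) }.

Section BGG.
Variables (K : fieldType) (A : galg K) (D : tridec A).

Definition T_alg : galg K := sub_galg (td_zero D).

Definition Bpos : gsub A := prod_gsub (td_zero_deg D) (td_posC D).
Definition Bneg : gsub A := prod_gsub (td_zero_deg D) (td_negC D).

Definition quot_pos : ghom (sub_galg Bpos) T_alg :=
  prod_quot (td_zero_deg D) (td_posC D) (or_introl (td_pos_deg D)) (td_pos0 D).
Definition quot_neg : ghom (sub_galg Bneg) T_alg :=
  prod_quot (td_zero_deg D) (td_negC D) (or_intror (td_neg_deg D)) (td_neg0 D).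

(* Delta(l) = A (x)_{B^+} l *)
Definition standard (l : gmod T_alg) : gmod A :=
  gind (sub_incl Bpos) (gres quot_pos l).

(* Nabla(l) = (A^op (x)_{(B^-)^op} l^* )^* , an A-module through A = (A^op)^op *)
Definition costandard (l : gmod T_alg) : gmod A :=
  gres (gopop A)
    (gdual (gind (gop_hom (sub_incl Bneg)) (gres (gop_hom quot_neg) (gdual l)))).

Definition BGG : Prop :=
  forall l : gmod T_alg, gsimple l ->
    K0eq (K0class (standard l)) (K0class (costandard l)).

Definition Bpos_bimod : gbimod T_alg :=
  hom_bimod (sub_subincl (sub_prod_gsub (td_zero_deg D) (td_posC D))).
Definition Bneg_bimod : gbimod T_alg :=
  hom_bimod (sub_subincl (sub_prod_gsub (td_zero_deg D) (td_negC D))).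
End BGG.

(* Main.v *)
Require Import Defs.
From mathcomp Require Import all_boot all_order all_algebra falgebra.
From mathcomp Require Import zify.
From Stdlib Require Import Setoid Morphisms.

(** Over the split semisimple algebra T everything is detected by dimensions.
    Matrix units of T ([semisimple_units]) provide orthogonal idempotents e_i
    with sum 1 such that every simple T-module is isomorphic to some T e_i.
    A graded T-bimodule M is then determined up to isomorphism by the
    dimensions of the corners e_i M_d e_j: linear isomorphisms between corners
    glue to an isomorphism of bimodules ([gbimod_isoP]).

    In the Grothendieck group of A the class of a graded module M is determined
    by the dimensions of the spaces e_i M_j ([K0eq_ch]), because restriction to
    T is injective on Grothendieck groups.  Indeed, on its top degree A acts
    through T; so if M and N have the same dimensions, a vector m = e_k m in the
    top degree of M has a partner n = e_k n in N, and the submodule generated by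
    (m, n) in the sum of M and N maps to both, with nonzero images.  Comparing
    the kernels and cokernels of these two maps reduces the claim to modules of
    smaller dimension.

    It remains to compute the dimensions of standard and costandard modules.
    A simple graded T-module l is generated by a vector v = e_k v of some degree
    d, with annihilator T (1 - e_k).  As A is the product of B^- and B^+, the map
    sending x b to x b_0 (x in B^-, b in B^+, and b_0 the part of degree 0)
    is a projection of A onto B^-, and it identifies the A-module induced from l
    with B^- e_k, shifted by d ([ch_standard]).  The same argument in the
    opposite algebra identifies the costandard module with the dual of e_k B^+
    ([ch_costandard]).

    Hence A is BGG if and only if e_i B^-_d e_k and e_k B^+_{-d} e_i have the same
    dimension for all i, k, d.  The latter space is dual to the corner
    e_i X_d e_k of the dual bimodule X of B^+, so this says that the bimodules
    B^- and X have the same corner dimensions, that is, that they are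
    isomorphic. *)

Set Implicit Arguments.
Unset Strict Implicit.
Unset Printing Implicit Defensive.

Import Order.TTheory GRing.Theory Num.Theory.
Local Open Scope ring_scope.

(** * Images of idempotent operators *)
Section LinearAlgebra.
Variable K : fieldType.

Lemma img_idem (V : vectType K) (x : 'End(V)) v :
  (forall u, x (x u) = x u) -> v \in limg x -> x v = v.
Proof. by move=> xx /memv_imgP[u _ ->]. Qed.

Lemma dim_limg_transport (V W : vectType K) (h : V -> W)
    (x : 'End(V)) (y : 'End(W)) :
  linear h -> bijective h -> (forall v, h (x v) = y (h v)) ->
  \dim (limg x) = \dim (limg y).
Proof.
move=> hL [h' hK h'K] hx; pose H : 'Hom(V, W) := linfun h.
have HE v : H v = h v by rewrite linfun_linE.
have kerH : lker H == 0%VS.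
  by apply/lker0P=> u v; rewrite !HE => /(can_inj hK).
rewrite -(limg_dim_eq (f := H) (U := limg x)); last by rewrite (eqP kerH) capv0.
congr (\dim _); apply/vspaceP=> w; apply/idP/idP.
  by case/memv_imgP=> _ /memv_imgP[v _ ->] ->; rewrite HE hx memv_img ?memvf.
case/memv_imgP=> v _ ->; rewrite -(h'K v) -hx -HE.
by do 2!apply: memv_img; rewrite memvf.
Qed.

(** Applying an idempotent is an exact functor: this is what makes the
    dimensions of the pieces e M_i additive on short exact sequences. *)
Lemma dim_limg_exact (U V W : vectType K) (f : 'Hom(U, V)) (h : 'Hom(V, W))
    (x : 'End(U)) (y : 'End(V)) (z : 'End(W)) :
  lker f = 0%VS -> limg f = lker h -> limg h = fullv ->
  (forall v, y (y v) = y v) ->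
  (forall u, f (x u) = y (f u)) -> (forall v, h (y v) = z (h v)) ->
  \dim (limg y) = (\dim (limg x) + \dim (limg z))%N.
Proof.
move=> kf fh sh yy fx hy; rewrite -(limg_ker_dim h (limg y)).
congr (_ + _)%N; last first.
  by rewrite -sh -2!limg_comp; congr (\dim (limg _)); apply/lfunP=> v; rewrite !comp_lfunE.
rewrite -(limg_dim_eq (f := f) (U := limg x)) ?kf ?capv0 //.
congr (\dim _); apply/vspaceP=> v; apply/idP/idP.
  rewrite memv_cap -fh => /andP[yv /memv_imgP[u _ vE]].
  by rewrite -(img_idem yy yv) vE -fx; do 2!apply: memv_img; rewrite memvf.
case/memv_imgP=> _ /memv_imgP[u _ ->] ->.
by rewrite memv_cap -fh {1}fx !memv_img ?memvf.
Qed.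

(** The image of the transpose of an idempotent x is the dual of the image of x. *)
Lemma dim_limg_dual (V : vectType K) (x : 'End(V)) (y : 'End(vdual V)) :
  (forall v, x (x v) = x v) -> (forall f, y f = (f \o x)%VF) ->
  \dim (limg y) = \dim (limg x).
Proof.
move=> xx yE; pose W := subvs_of (limg x).
have [p pE] : exists p : 'Hom(V, W), forall v, vsval (p v) = x v.
  exists (linfun (vsproj (limg x)) \o x)%VF => v.
  by rewrite comp_lfunE lfunE /= vsprojK // memv_img ?memvf.
pose P : 'Hom(vdual W, vdual V) := linfun (fun f : vdual W => (f \o p)%VF : vdual V).
have PE f : P f = (f \o p)%VF.
  by rewrite linfun_linE // => k u v; rewrite comp_lfunDl comp_lfunZl.
have pval w : p (vsval w) = w.
  by apply: val_inj; rewrite [LHS]pE (img_idem xx) // subvsP.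
transitivity (\dim (limg P)); last first.
  rewrite limg_dim_eq; first by rewrite dimvf; exact: muln1.
  apply/eqP; rewrite -subv0; apply/subvP=> f; rewrite memv_cap memv_ker PE memv0.
  case/andP=> _ /eqP f0; apply/eqP/lfunP=> w.
  by rewrite -[w in LHS]pval -comp_lfunE f0 !zero_lfunE.
congr (\dim _); apply/vspaceP=> f; apply/idP/idP.
  case/memv_imgP=> g _ ->; rewrite yE.
  suff -> : (g \o x)%VF = P (g \o linfun vsval)%VF by rewrite memv_img ?memvf.
  by apply/lfunP=> v; rewrite PE !comp_lfunE lfunE /= pE.
case/memv_imgP=> g _ ->; rewrite PE.
suff -> : (g \o p)%VF = y (g \o p)%VF by rewrite memv_img ?memvf.
rewrite yE; apply/lfunP=> v; rewrite !comp_lfunE /=; congr (g _).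
by apply: val_inj; rewrite [LHS]pE [RHS]pE xx.
Qed.

(** An isomorphism between two subspaces, presented by maps defined on the whole
    spaces, so that it composes with operators without subtypes. *)
Lemma equidim_iso (V W : vectType K) (X : {vspace V}) (Y : {vspace W}) :
  \dim X = \dim Y ->
  exists f : 'Hom(V, W), exists g : 'Hom(W, V),
  [/\ forall v, f v \in Y, forall w, g w \in X,
      {in X, cancel f g} & {in Y, cancel g f}].
Proof.
move=> dXY; pose n := \dim X.
have [s sX] : exists s : n.-tuple V, basis_of X s by exists (vbasis X); exact: vbasisP.
have [t tY] : exists t : n.-tuple W, basis_of Y t.
  by exists (tcast (esym dXY) (vbasis Y)); rewrite val_tcast; exact: vbasisP.
pose F (V1 W1 : vectType K) (s1 : n.-tuple V1) (t1 : n.-tuple W1) (v : V1) : W1 :=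
  \sum_(i < n) coord s1 i v *: t1`_i.
have FL V1 W1 s1 t1 : linear (@F V1 W1 s1 t1).
  move=> k u v; rewrite /F scaler_sumr -big_split; apply: eq_bigr => i _ /=.
  by rewrite linearP scalerDl scalerA.
have FY (V1 W1 : vectType K) (X1 : {vspace W1}) (s1 : n.-tuple V1)
    (t1 : n.-tuple W1) v : basis_of X1 t1 -> @F V1 W1 s1 t1 v \in X1.
  move=> t1X; apply: memv_suml => i _; rewrite memvZ // (basis_mem t1X) //.
  by rewrite mem_nth ?size_tuple.
have FK (V1 W1 : vectType K) (X1 : {vspace V1}) (Y1 : {vspace W1})
    (s1 : n.-tuple V1) (t1 : n.-tuple W1) :
    basis_of X1 s1 -> basis_of Y1 t1 -> {in X1, cancel (@F V1 W1 s1 t1) (F W1 V1 t1 s1)}.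
  move=> s1X t1Y v Xv; rewrite [RHS](coord_basis s1X Xv); apply: eq_bigr => i _.
  congr (_ *: _); rewrite linear_sum (bigD1 i) //= linearZ /= coord_free ?(basis_free t1Y) //.
  rewrite eqxx mulr1 big1 ?addr0 // => j ji.
  by rewrite linearZ /= coord_free ?(basis_free t1Y) // (negPf ji) mulr0.
exists (linfun (F V W s t)), (linfun (F W V t s)).
split=> [v|w|v vX|w wY]; rewrite !linfun_linE //; do ?exact: FL; do ?exact: FY.
  by rewrite (FK _ _ X Y).
by rewrite (FK _ _ Y X).
Qed.

(** * Gluing linear isomorphisms along matrix units *)
Section MatrixUnits.
Variables (I : finType) (r : I -> I).

(** The operators [a i] and [b i] behave like matrix units E_{i,r(i)} and
    E_{r(i),i}, where [r] chooses a representative in each class of indices: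
    [a i \o b i] is a projection onto a summand of V, and the summands of i and
    of [r i] are identified by [a i] and [b i]. *)
Definition unit_system (V : vectType K) (a b : I -> 'End(V)) : Prop :=
  (forall i j v, b i (a j v) = if i == j then a (r i) (b (r i) v) else 0) /\
  (forall v, \sum_i a i (b i v) = v).

(** Inserting the partition of unity before [b i] kills all terms but one. *)
Lemma unit_system_idem (V : vectType K) (a b : I -> 'End(V)) i v :
  unit_system a b -> a (r i) (b (r i) (b i v)) = b i v.
Proof.
case=> ba ab1; rewrite -[in RHS](ab1 v) linear_sum (bigD1 i) //= ba eqxx.
by rewrite big1 ?addr0 // => j ji; rewrite ba eq_sym (negPf ji).
Qed.

Lemma unit_system_img (V : vectType K) (a b : I -> 'End(V)) i v :
  unit_system a b -> v \in limg (a (r i) \o b (r i)) -> a (r i) (b (r i) v) = v.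
Proof.
move=> ab vP; rewrite -comp_lfunE img_idem // => u; rewrite !comp_lfunE.
by have [ba _] := ab; have := ba i i u; rewrite eqxx => <-; rewrite unit_system_idem.
Qed.

(** Transports each summand of V to the summand of its representative, applies
    there the map [f], and transports back in W. *)
Definition glue (V W : vectType K) (b : I -> 'End(V)) (c : I -> 'End(W))
    (f : I -> 'Hom(V, W)) (v : V) : W :=
  \sum_i c i (f (r i) (b i v)).

Lemma glue_linear V W b c f : linear (@glue V W b c f).
Proof.
move=> k u v; rewrite /glue scaler_sumr -big_split; apply: eq_bigr => i _ /=.
by rewrite !linearP.
Qed.

Lemma glueK (V W : vectType K) (a b : I -> 'End(V)) (c d : I -> 'End(W))
    (f : I -> 'Hom(V, W)) (g : I -> 'Hom(W, V)) :
  unit_system a b -> unit_system c d ->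
  (forall i v, f i v \in limg (c i \o d i)) ->
  (forall i, {in limg (a i \o b i), cancel (f i) (g i)}) ->
  cancel (glue b c f) (glue d a g).
Proof.
move=> ab cd fc fK v; rewrite -[RHS](proj2 ab); apply: eq_bigr => i _.
rewrite linear_sum (bigD1 i) //= (proj1 cd) eqxx big1 => [|j ji]; last first.
  by rewrite (proj1 cd) eq_sym (negPf ji).
rewrite addr0 (unit_system_img cd (fc _ _)) fK //.
by rewrite -(unit_system_idem i v ab) -comp_lfunE memv_img ?memvf.
Qed.

(** V is the direct sum of the images of [a i \o b i], and each of them is a copy
    of the one of index [r i]; so it is enough to choose isomorphisms for the
    representatives, and the glued map commutes with the operators
    [a i \o b j], which identify summands of the same class. *)
Lemma glue_iso (V W : vectType K) (a b : I -> 'End(V)) (c d : I -> 'End(W)) :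
  unit_system a b -> unit_system c d ->
  (forall i, \dim (limg (a i \o b i)) = \dim (limg (c i \o d i))) ->
  exists2 f : 'Hom(V, W), bijective f &
    forall i j, r i = r j -> forall v, f (a i (b j v)) = c i (d j (f v)).
Proof.
move=> ab cd dE.
have /fin_all_exists[f /fin_all_exists[g fgP]] i := equidim_iso (dE i).
exists (linfun (glue b c f)) => [|i j rij v].
  exists (glue d a g) => v; rewrite linfun_linE; do ?exact: glue_linear.
    by apply: glueK v => // i; case: (fgP i).
  by apply: glueK v => // i; case: (fgP i).
rewrite !linfun_linE; do ?exact: glue_linear.
rewrite /glue (bigD1 i) //= (proj1 ab) eqxx big1 => [|k ki]; last first.
  by rewrite (proj1 ab) (negPf ki) !linear0.
rewrite addr0 linear_sum (bigD1 j) //= (proj1 cd) eqxx big1 => [|k kj]; last first.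
  by rewrite (proj1 cd) eq_sym (negPf kj).
rewrite !addr0 rij unit_system_idem // (unit_system_img cd) //.
by case: (fgP (r j)).
Qed.
End MatrixUnits.
End LinearAlgebra.

(** * Graded modules and their dimensions at an idempotent *)
Section GradedModuleTheory.
Variables (K : fieldType) (A : galg K).
Implicit Types M N P : gmod A.

(** A map of degree d moves the component of degree i to that of degree i + d. *)
Lemma gproj_shift (V W : vectType K) (gV : grading V) (gW : grading W)
    (f : 'Hom(V, W)) (d : int) :
  (forall i v, v \in gV i -> f v \in gW (i + d)) ->
  forall i v, f (gproj gV i v) = gproj gW (i + d) (f v).
Proof.
move=> fd i v; rewrite -[in RHS](sum_gproj gV v) !linear_sum.
have E j : gproj gW (i + d) (f (gproj gV j v)) = if i == j then f (gproj gV j v) else 0.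
  by rewrite (gproj_gdeg _ (fd _ _ (gproj_in _ _ _))) (inj_eq (addIr d)).
under eq_bigr => j _ do rewrite /= E.
have [si|s'i] := boolP (i \in gsupp gV).
  rewrite (big_rem _ si) /= eqxx big_seq big1 ?addr0 // => j.
  by rewrite mem_rem_uniq ?gsupp_uniq // inE eq_sym => /andP[/negPf->].
rewrite (gdeg_out s'i (gproj_in _ _ v)) linear0 big_seq big1 // => j sj.
by case: eqP => // ij; rewrite ij sj in s'i.
Qed.

Lemma gmod_hom_gproj M N (f : 'Hom(M, N)) i m :
  gmod_hom f -> f (gproj (gm_gr M) i m) = gproj (gm_gr N) i (f m).
Proof.
case=> _ fg; have := gproj_shift (f := f) (d := 0) (gV := gm_gr M) (gW := gm_gr N).
by move=> /(_ _ i m) ->; rewrite ?addr0 // => j v; rewrite addr0; apply: fg.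
Qed.

Lemma gproj_act M (a : A) i d m : a \in ggr A d ->
  lm_act M a (gproj (gm_gr M) i m) = gproj (gm_gr M) (i + d) (lm_act M a m).
Proof.
move=> ad; apply: (gproj_shift (f := lm_act M a)) => j v vj.
by rewrite addrC; apply: gm_actP ad vj.
Qed.

Lemma gprojK (V : vectType K) (g : grading V) i j v :
  gproj g i (gproj g j v) = if i == j then gproj g j v else 0.
Proof. exact: gproj_gdeg (gproj_in _ _ _). Qed.

(** The operator whose image is the space e M_i. *)
Definition cut M (a : A) (i : int) : 'End(M) :=
  (lm_act M a \o gproj (gm_gr M) i)%VF.

Lemma cutE M a i m : cut M a i m = lm_act M a (gproj (gm_gr M) i m).
Proof. by rewrite comp_lfunE. Qed.

Lemma lm_actMM (B : falgType K) (M : lmod B) a b m :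
  lm_act M a (lm_act M b m) = lm_act M (a * b) m.
Proof. by rewrite lm_actM comp_lfunE. Qed.

Lemma lm_act1E (B : falgType K) (M : lmod B) m : lm_act M 1 m = m.
Proof. by rewrite lm_act1 id_lfunE. Qed.

Lemma cut_idem M e i m : e \in ggr A 0 -> e * e = e ->
  cut M e i (cut M e i m) = cut M e i m.
Proof.
move=> e0 ee; rewrite !cutE (gproj_act _ _ e0) addr0 lm_actMM ee.
by rewrite -[in LHS](addr0 i) -gproj_act // gprojK addr0 eqxx.
Qed.

Definition ch M (e : A) (i : int) : nat := \dim (limg (cut M e i)).

Fixpoint K0ch (e : A) (i : int) (x : K0 A) : int :=
  match x with
  | K0class M => (ch M e i)%:Z
  | K0zero => 0
  | K0opp x => - K0ch e i x
  | K0add x y => K0ch e i x + K0ch e i y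
  end.

(** An idempotent of degree 0 commutes with the projections on the components,
    so that [cut] is idempotent and [dim_limg_exact] applies to every short exact
    sequence. *)
Lemma K0ch_eq e i x y : e \in ggr A 0 -> e * e = e ->
  K0eq x y -> K0ch e i x = K0ch e i y.
Proof.
move=> e0 ee; elim=> //=.
- by move=> ? ? ? _ -> _ ->.
- by move=> ? ? _ ->.
- by move=> ? ? ? ? _ -> _ ->.
- by move=> ? ? ?; rewrite addrA.
- by move=> ? ?; rewrite addrC.
- by move=> ?; rewrite add0r.
- by move=> ?; rewrite addNr.
move=> M1 M2 M3 f h [fh hh kf fE hf]; rewrite -PoszD /ch.
rewrite (dim_limg_exact (x := cut M1 e i) (z := cut M3 e i) kf fE hf) //.
- by move=> v; apply: cut_idem.
- by move=> u; rewrite !cutE -(gmod_hom_gproj _ _ fh) (proj1 fh).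
by move=> u; rewrite !cutE -(gmod_hom_gproj _ _ hh) (proj1 hh).
Qed.

Lemma K0dim_exact M1 M2 M3 (f : 'Hom(M1, M2)) (h : 'Hom(M2, M3)) :
  short_exact f h -> \dim {:M2} = (\dim {:M1} + \dim {:M3})%N.
Proof.
case=> fh hh kf fE hf; rewrite -(limg_ker_dim h fullv) hf -fE capfv.
by rewrite limg_dim_eq // kf capv0.
Qed.

Definition gstable M (U : {vspace M}) : Prop :=
  submod U /\ forall i m, m \in U -> gproj (gm_gr M) i m \in U.

(** Submodules and quotients are built at once: their underlying space W is a
    retract of M, by [s : W -> M] and [p : M -> W], and an operator x of M acts
    on W by [p \o x \o s].  For this to be compatible with composition one needs
    [cmp], which holds for operators preserving U both when W is U and when W is
    a complement of U that stands for the quotient by U. *)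
Section Retract.
Variables (M : gmod A) (U : {vspace M}) (W : vectType K).
Variables (s : 'Hom(W, M)) (p : 'Hom(M, W)).
Hypothesis Ust : gstable U.
Hypothesis sK : cancel s p.
Hypothesis cmp : forall x y : 'End(M),
  (forall u, u \in U -> x u \in U) -> (forall u, u \in U -> y u \in U) ->
  forall w, p (x (s (p (y (s w))))) = p (x (y (s w))).

Local Notation g := (gproj (gm_gr M)).

Definition retract_act : 'Hom(A, 'End(W)) :=
  linfun (fun a => (p \o lm_act M a \o s)%VF).

Lemma retract_actE a w : retract_act a w = p (lm_act M a (s w)).
Proof.
rewrite linfun_linE ?comp_lfunE // => k x y; apply/lfunP=> v.
by rewrite !(add_lfunE, scale_lfunE, comp_lfunE) linearP /= add_lfunE scale_lfunE linearP.
Qed.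

Fact retract_act1 : retract_act 1 = \1%VF.
Proof. by apply/lfunP=> w; rewrite retract_actE lm_act1E id_lfunE sK. Qed.

Fact retract_actM a b : retract_act (a * b) = (retract_act a \o retract_act b)%VF.
Proof.
apply/lfunP=> w; rewrite comp_lfunE !retract_actE cmp ?lm_actMM // => u.
  exact: (proj1 Ust).
exact: (proj1 Ust).
Qed.

Definition retract_lmod : lmod A := LMod retract_act1 retract_actM.

Definition retract_deg i : {vspace W} := limg (p \o g i \o s)%VF.

Lemma retract_degP i w : reflect (w = p (g i (s w))) (w \in retract_deg i).
Proof.
apply: (iffP idP) => [/memv_imgP[v _ ->]|->]; last first.
  by rewrite -!comp_lfunE memv_img ?memvf.
rewrite !comp_lfunE cmp ?gprojK ?eqxx // => u; exact: (proj2 Ust).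
Qed.

Fact retract_is_grading : is_grading retract_deg.
Proof.
have gU i u : u \in U -> g i u \in U by apply: (proj2 Ust).
apply: (is_gradingP (p := fun i => (p \o g i \o s)%VF)) => [i v|i j v|].
- by rewrite memv_img ?memvf.
- move/retract_degP->; rewrite !comp_lfunE cmp; try exact: gU.
  by rewrite gprojK; case: eqP => // _; rewrite linear0.
exists (gsupp (gm_gr M)) => w; rewrite -{1}(sK w) -{1}(sum_gproj (gm_gr M) (s w)).
by rewrite linear_sum; apply: eq_bigr => i _; rewrite !comp_lfunE.
Qed.

Fact retract_actP i j a (w : retract_lmod) : a \in ggr A i ->
  w \in retract_deg j -> lm_act retract_lmod a w \in retract_deg (i + j).
Proof.
move=> ai /retract_degP wE; apply/retract_degP.
have gU k u : u \in U -> g k u \in U by apply: (proj2 Ust).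
have aU u : u \in U -> lm_act M a u \in U by apply: (proj1 Ust).
have agU (u : M) : u \in U -> (lm_act M a \o g j)%VF u \in U.
  by move=> uU; rewrite comp_lfunE; apply/aU/gU.
have E : retract_act a w = p (lm_act M a (g j (s w))).
  by rewrite retract_actE {1}wE cmp; [|exact: aU|exact: gU].
rewrite [lm_act _ a w]E -[lm_act M a _]comp_lfunE cmp; [|exact: gU|exact: agU].
rewrite comp_lfunE; congr (p _).
by rewrite (gproj_act _ _ ai) gprojK addrC eqxx.
Qed.

Definition retract : gmod A :=
  @GMod K A retract_lmod (Grading retract_is_grading) retract_actP.
End Retract.

Lemma sub_gmodP M (U : {vspace M}) : gstable U ->
  exists N, exists f : 'Hom(N, M), [/\ gmod_hom f, lker f = 0%VS & limg f = U].
Proof.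
move=> Ust; pose s : 'Hom(subvs_of U, M) := linfun vsval.
pose p : 'Hom(M, subvs_of U) := linfun (vsproj U).
have sE w : s w = vsval w by rewrite lfunE.
have pE v : p v = vsproj U v by rewrite lfunE.
have psK u : u \in U -> s (p u) = u by move=> uU; rewrite sE pE vsprojK.
have sU w : s w \in U by rewrite sE subvsP.
have sK : cancel s p by move=> w; rewrite sE pE vsvalK.
have cmp (x y : 'End(M)) : (forall u, u \in U -> x u \in U) ->
    (forall u, u \in U -> y u \in U) ->
    forall w, p (x (s (p (y (s w))))) = p (x (y (s w))).
  by move=> xU yU w; rewrite psK ?yU.
clearbody s p; pose N := retract Ust sK cmp; exists N, s; split.
- split=> [a m|i m]; first by rewrite [lm_act N a m]retract_actE psK // (proj1 Ust).
  by move/(retract_degP Ust cmp)->; rewrite psK ?gproj_in // (proj2 Ust).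
- by apply/eqP/lker0P; exact: can_inj sK.
apply/vspaceP=> v; apply/idP/idP; first by case/memv_imgP=> w _ ->.
by move=> vU; rewrite -(psK v vU) memv_img ?memvf.
Qed.

(** The quotient is realised on a complement of U; an element and its image in
    the complement differ by an element of U, which gives the compatibility
    condition of the retract. *)
Lemma quot_gmodP M (U : {vspace M}) : gstable U ->
  exists N, exists h : 'Hom(M, N), [/\ gmod_hom h, lker h = U & limg h = fullv].
Proof.
move=> Ust; pose s : 'Hom(quot U, M) := linfun vsval.
pose p : 'Hom(M, quot U) := qproj U.
have sE w : s w = vsval w by rewrite lfunE.
have sK : cancel s p by move=> w; rewrite sE; apply: qprojK.
have pU u : u \in U -> p u = 0 by apply: qproj_eq0.
have psU v : s (p v) - v \in U.
  by rewrite sE vsval_qproj addrC addKr memvN memv_proj.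
have pker u : p u = 0 -> u \in U.
  by move=> pu; have := psU u; rewrite pu linear0 sub0r memvN.
have xsp (x : 'End(M)) : (forall u, u \in U -> x u \in U) ->
    forall v, p (x (s (p v))) = p (x v).
  by move=> xU v; apply/eqP; rewrite -subr_eq0 -!linearB; apply/eqP/pU/xU/psU.
have cmp (x y : 'End(M)) : (forall u, u \in U -> x u \in U) ->
    (forall u, u \in U -> y u \in U) ->
    forall w, p (x (s (p (y (s w))))) = p (x (y (s w))).
  by move=> xU _ w; rewrite xsp.
clearbody s p; pose N := retract Ust sK cmp; exists N, p; split.
- split=> [a m|i m mi].
    by rewrite [lm_act N a _]retract_actE xsp // => u; apply: (proj1 Ust).
  apply/(retract_degP Ust cmp); rewrite xsp ?(gproj_id mi) // => u; exact: (proj2 Ust).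
- by apply/vspaceP=> v; rewrite memv_ker; apply/eqP/idP => [/pker|/pU].
by apply/vspaceP=> w; rewrite memvf -(sK w) memv_img ?memvf.
Qed.

Section DirectSum.
Variables M N : gmod A.
Let W : vectType K := (M * N)%type.

Definition sum_act : 'Hom(A, 'End(W)) :=
  bilin (fun a (x : W) => (lm_act M a x.1, lm_act N a x.2) : W).

Lemma sum_actE a x : sum_act a x = (lm_act M a x.1, lm_act N a x.2).
Proof.
rewrite /sum_act bilinE // => [b k u v|v k u w].
  by rewrite !linearP.
by rewrite !linearP /= !add_lfunE !scale_lfunE.
Qed.

Fact sum_act1 : sum_act 1 = \1%VF.
Proof. by apply/lfunP=> -[m n]; rewrite sum_actE !lm_act1E id_lfunE. Qed.

Fact sum_actM a b : sum_act (a * b) = (sum_act a \o sum_act b)%VF.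
Proof. by apply/lfunP=> -[m n]; rewrite comp_lfunE !sum_actE !lm_actMM. Qed.

Definition sum_lmod : lmod A := LMod sum_act1 sum_actM.

Definition sum_deg i : {vspace W} :=
  ((linfun (fun x : W => x.1) @^-1: gm_gr M i) :&:
   (linfun (fun x : W => x.2) @^-1: gm_gr N i))%VS.

Lemma sum_degE i (x : W) : (x \in sum_deg i) = (x.1 \in gm_gr M i) && (x.2 \in gm_gr N i).
Proof. by rewrite memv_cap -!memv_preim !linfun_linE. Qed.

Fact sum_is_grading : is_grading sum_deg.
Proof.
pose p i : 'End(W) := linfun (fun x : W => (gproj (gm_gr M) i x.1, gproj (gm_gr N) i x.2) : W).
have pE i x : p i x = (gproj (gm_gr M) i x.1, gproj (gm_gr N) i x.2).
  by rewrite linfun_linE // => k u v; rewrite !linearP.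
apply: (is_gradingP (p := p)) => [i x|i j x|].
- by rewrite pE sum_degE /= !gproj_in.
- rewrite pE sum_degE => /andP[x1 x2].
  by rewrite (gproj_gdeg i x1) (gproj_gdeg i x2); case: (x) => m n; case: ifP.
pose t := undup (gsupp (gm_gr M) ++ gsupp (gm_gr N)).
have tE (X : vectType K) (g : grading X) v : {subset gsupp g <= t} ->
    v = \sum_(i <- t) gproj g i v.
  move=> gt; rewrite -{1}(sum_gproj g v) [RHS](bigID (mem (gsupp g))) /=.
  rewrite [X in _ + X]big1 ?addr0 => [|i gi]; last exact: gdeg_out gi (gproj_in _ _ _).
  rewrite -[RHS]big_filter; apply: perm_big; apply: uniq_perm.
  - exact: gsupp_uniq.
  - by rewrite filter_uniq ?undup_uniq.
  by move=> i; rewrite mem_filter; case gi: (i \in gsupp g) => //=; rewrite gt.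
exists t => -[m n]; under eq_bigr => i _ do rewrite pE /=.
rewrite {1}(tE _ (gm_gr M) m) => [|i si]; last by rewrite mem_undup mem_cat si.
rewrite {1}(tE _ (gm_gr N) n) => [|i si]; last by rewrite mem_undup mem_cat si orbT.
by elim: t {tE} => [|i t IHt]; rewrite ?big_nil // !big_cons -IHt.
Qed.

Fact sum_gactP i j a (x : sum_lmod) : a \in ggr A i ->
  x \in sum_deg j -> lm_act sum_lmod a x \in sum_deg (i + j).
Proof.
rewrite [lm_act sum_lmod a x]sum_actE !sum_degE => ai /andP[x1 x2].
by rewrite /= !(gm_actP ai).
Qed.

Definition gsum : gmod A :=
  @GMod K A sum_lmod (Grading sum_is_grading) sum_gactP.
End DirectSum.
End GradedModuleTheory.

(** * The Grothendieck group is detected on the degree zero part *)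
Section Grothendieck.
Variables (K : fieldType) (A : galg K).
Implicit Types M N P Z : gmod A.

#[local] Hint Resolve K0eq_refl : core.

#[local] Instance K0eq_equiv : Equivalence (@K0eq K A).
Proof.
split; [exact: K0eq_refl|exact: K0eq_sym|exact: K0eq_trans].
Qed.

#[local] Instance K0add_proper : Proper (@K0eq K A ==> @K0eq K A ==> @K0eq K A) (@K0add K A).
Proof. by move=> x x' xx' y y' yy'; apply: K0eq_add. Qed.

Lemma K0add_cancel (x y z : K0 A) : K0eq (K0add x z) (K0add y z) -> K0eq x y.
Proof.
have H w : K0eq (K0add (K0add w z) (K0opp z)) w.
  by rewrite -K0eq_addA (K0eq_addC z) K0eq_addN K0eq_addC K0eq_add0.
by move=> xyz; rewrite -(H x) -(H y) xyz.
Qed.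

(** The zero module is an extension of itself by itself. *)
Lemma K0class0 M : (fullv : {vspace M}) = 0%VS -> K0eq (K0class M) (K0zero A).
Proof.
move=> M0; apply: (@K0add_cancel _ _ (K0class M)); rewrite K0eq_add0.
symmetry; apply: (@K0eq_exact K A M M M 0 0).
have all0 (U : {vspace M}) : U = 0%VS by apply/eqP; rewrite -subv0 -M0 subvf.
have h0 : gmod_hom (0 : 'Hom(M, M)).
  by split=> [a m|i m _]; rewrite !zero_lfunE ?linear0 ?mem0v.
by split=> //; do ?exact: all0; rewrite [LHS]all0 [RHS]all0.
Qed.

Lemma gsum_exact M N :
  exists f : 'Hom(M, gsum M N), exists h : 'Hom(gsum M N, N), short_exact f h.
Proof.
pose f : 'Hom(M, gsum M N) := linfun (fun m => (m, 0) : (M * N)%type).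
pose h : 'Hom(gsum M N, N) := linfun (fun x : (M * N)%type => x.2).
have fE m : f m = (m, 0).
  by rewrite linfun_linE // => k u v; congr (_, _); rewrite /= scaler0 addr0.
have hE x : h x = x.2 by rewrite linfun_linE.
exists f, h; split.
- split=> [a m|i m mi]; first by rewrite [lm_act (gsum M N) a _]sum_actE !fE linear0.
  by rewrite [_ \in _]sum_degE fE mem0v andbT.
- split=> [a x|i x]; first by rewrite [lm_act (gsum M N) a _]sum_actE !hE.
  by rewrite [_ \in _]sum_degE hE => /andP[].
- by apply/eqP/lker0P => u v; rewrite !fE => -[].
- apply/vspaceP=> -[m n]; rewrite memv_ker hE /=; apply/idP/eqP.
    by case/memv_imgP=> w _; rewrite fE => -[].
  by move=> ->; rewrite -fE memv_img ?memvf.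
apply/vspaceP=> n; rewrite memvf -[n]/((0 : M, n).2) -hE memv_img ?memvf //.
Qed.

Lemma K0gsum M N : K0eq (K0class (gsum M N)) (K0add (K0class M) (K0class N)).
Proof. by have [f [h fh]] := gsum_exact M N; exact: K0eq_exact fh. Qed.

Lemma dim_gsum M N : \dim {:gsum M N} = (\dim {:M} + \dim {:N})%N.
Proof. by have [f [h fh]] := gsum_exact M N; exact: K0dim_exact fh. Qed.

Lemma lker_gstable M N (f : 'Hom(M, N)) : gmod_hom f -> gstable (lker f).
Proof.
move=> fh; split=> [a m|i m]; rewrite !memv_ker => /eqP fm.
  by rewrite (proj1 fh) fm linear0.
by rewrite (gmod_hom_gproj _ _ fh) fm linear0.
Qed.

Lemma limg_gstable M N (f : 'Hom(M, N)) : gmod_hom f -> gstable (limg f).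
Proof.
move=> fh; split=> [a _ /memv_imgP[m _ ->]|i _ /memv_imgP[m _ ->]].
  by rewrite -(proj1 fh) memv_img ?memvf.
by rewrite -(gmod_hom_gproj _ _ fh) memv_img ?memvf.
Qed.

(** The relation given by the four-term exact sequence of kernel R and cokernel C
    of f, obtained by splicing two short ones at M / ker f. *)
Lemma K0_ker_coker M N (f : 'Hom(M, N)) : gmod_hom f ->
  exists R C : gmod A,
  [/\ K0eq (K0add (K0class M) (K0class C)) (K0add (K0class N) (K0class R)),
      \dim {:R} = \dim (lker f) &
      (\dim {:M} + \dim {:C} = \dim {:N} + \dim {:R})%N].
Proof.
move=> fh; have [R [j [jh kj jE]]] := sub_gmodP (lker_gstable fh).
have [Q [q [qh kq qE]]] := quot_gmodP (lker_gstable fh).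
have [C [c [ch kc cE]]] := quot_gmodP (limg_gstable fh).
have qV z : q ((q^-1)%VF z) = z by rewrite limg_lfunVK // qE memvf.
(* The injection of M / ker f into N induced by f. *)
pose f' := (f \o q^-1)%VF.
have f'q m : f' (q m) = f m.
  rewrite comp_lfunE; apply/eqP; rewrite -subr_eq0 -linearB -memv_ker -kq.
  by rewrite memv_ker linearB /= qV subrr.
have f'h : gmod_hom f'.
  split=> [a z|i z zi]; first by rewrite -(qV z) -(proj1 qh) !f'q (proj1 fh).
  rewrite -(qV z) f'q; have -> : f ((q^-1)%VF z) = gproj (gm_gr N) i (f ((q^-1)%VF z)).
    rewrite -(gmod_hom_gproj _ _ fh) -!f'q (gmod_hom_gproj _ _ qh) qV.
    by rewrite (gproj_id zi).
  exact: gproj_in.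
have E1 : short_exact j q by split; rewrite // jE kq.
have E2 : short_exact f' c.
  split=> //.
    apply/eqP/lker0P=> u v; rewrite -(qV u) -(qV v) !f'q => /eqP.
    by rewrite -subr_eq0 -linearB -memv_ker -kq memv_ker linearB subr_eq0 => /eqP.
  rewrite kc; apply/vspaceP=> n; apply/idP/idP => /memv_imgP[m _ ->].
    by rewrite -(qV m) f'q memv_img ?memvf.
  by rewrite -f'q memv_img ?memvf.
exists R, C; split.
- rewrite (K0eq_exact E1) (K0eq_exact E2).
  by rewrite -K0eq_addA (K0eq_addC (K0class R)).
- by rewrite -jE limg_dim_eq // kj capv0.
by rewrite (K0dim_exact E1) (K0dim_exact E2); lia.
Qed.

Lemma cyclic_gstable M (z : M) i :
  z \in gm_gr M i -> gstable (limg (linfun (fun a => lm_act M a z))).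
Proof.
move=> zi; have L : linear (fun a => lm_act M a z).
  by move=> k a b; rewrite linearP add_lfunE scale_lfunE.
split=> [a m /memv_imgP[b _ ->]|j m /memv_imgP[b _ ->]].
  rewrite linfun_linE // lm_actMM -[lm_act _ _ _](linfun_linE L).
  by rewrite memv_img ?memvf.
rewrite -(subrK i j) -(gproj_shift (gV := ggr A) (d := i)).
  by rewrite memv_img ?memvf.
by move=> k a ak; rewrite linfun_linE //; apply: gm_actP.
Qed.

Lemma max_int (s : seq int) : s != [::] -> exists2 i, i \in s & forall j, j \in s -> j <= i.
Proof.
elim: s => // i [|k s] IHs _; first by exists i; rewrite ?mem_head // => j; rewrite inE => /eqP->.
have [//|l ls lmax] := IHs; exists (Num.max i l).
  by case: (leP i l) => _; rewrite inE ?ls ?orbT ?eqxx.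
by move=> j; rewrite inE => /orP[/eqP->|/lmax jl]; rewrite le_max ?lexx // jl orbT.
Qed.

(** Finite dimension leaves finitely many nonzero components. *)
Lemma top_degree M : (fullv : {vspace M}) != 0%VS ->
  exists2 i, gm_gr M i != 0%VS & forall j, i < j -> gm_gr M j = 0%VS.
Proof.
move=> M0; pose s := [seq i <- gsupp (gm_gr M) | gm_gr M i != 0%VS].
have sP i : gm_gr M i != 0%VS -> i \in s.
  rewrite mem_filter => Mi; rewrite Mi /=; apply: contraR Mi => gi.
  by rewrite -subv0; apply/subvP=> v /(gdeg_out gi)->; rewrite mem0v.
have [] := @max_int s.
  apply: contraNneq M0 => s0; rewrite -(gsupp_full (gm_gr M)) big_seq big1 // => i gi.
  by apply/eqP; case: eqVneq => // /sP; rewrite s0.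
move=> i; rewrite mem_filter => /andP[Mi _] imax; exists i => // j ij.
by apply/eqP; apply: contraLR ij => /sP/imax; rewrite leNgt.
Qed.

Variables (T : galg K) (iota : ghom T A) (I : finType) (e : I -> T).
Hypotheses (T0 : forall t : T, t \in ggr T 0) (e1 : \sum_k e k = 1).
Hypothesis ee : forall k, e k * e k = e k.
Hypothesis e_simple : forall k t, t * e k != 0 -> exists s, s * (t * e k) = e k.
Hypothesis act_top : forall a : A, exists t : T, forall M i (m : M),
  m \in gm_gr M i -> (forall j, i < j -> gm_gr M j = 0%VS) ->
  gproj (gm_gr M) i (lm_act M a m) = lm_act M (iota t) m.

Lemma iota_deg0 t : iota t \in ggr A 0. Proof. exact: ghom_gr (T0 t). Qed.

(** T e_k is simple, so the map t e_k |-> t n is injective. *)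
Lemma e_annihilator (N : lmod T) (n : N) k t : n != 0 -> lm_act N (e k) n = n ->
  (lm_act N t n == 0) = (t * e k == 0).
Proof.
move=> n0 en; apply/eqP/eqP => [tn|te]; last first.
  by rewrite -en lm_actMM te linear0 zero_lfunE.
apply/eqP; case: eqVneq => // /e_simple[s sE]; case/eqP: n0.
by rewrite -en -sE -!lm_actMM en tn linear0.
Qed.

Lemma cut_neq0 M k i : ch M (iota (e k)) i != 0%N ->
  exists m : M, [/\ m != 0, m \in gm_gr M i & lm_act M (iota (e k)) m = m].
Proof.
rewrite dimv_eq0 -vpick0; set m := vpick _ => m0; exists m.
have /memv_imgP[w _ mE] : m \in limg (cut M (iota (e k)) i) by exact: memv_pick.
rewrite mE cutE lm_actMM -ghomM ee -cutE -mE; split=> //.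
by rewrite mE cutE -[i]add0r; apply: gm_actP (iota_deg0 _) _; rewrite add0r gproj_in.
Qed.

(** Induction on the total dimension of M and N.  Let i be the top degree of
    M + N.  Some e_k acts nontrivially in degree i of M, hence also of N, and this
    gives m = e_k m and n = e_k n in degree i.  Let Z be the submodule of M + N
    generated by (m, n), with projections f to M and g to N.  The exact sequences
    of f and g give
      [M] - [N] = ([coker f] + [ker g]) - ([coker g] + [ker f]).
    The part of degree i of Z is T (m, n), on which f and g are injective since
    m and n have the same annihilator in T.  So the sum of ker f and ker g is
    direct and is a proper subspace of Z, and this makes the total dimension of
    the modules on the right smaller than that of M and N. *)
Lemma K0eq_ch M N : (forall k i, ch M (iota (e k)) i = ch N (iota (e k)) i) ->
  K0eq (K0class M) (K0class N).
Proof.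
have [b] := ubnP (\dim {:M} + \dim {:N}); elim: b M N => // b IHb M N dMN chMN.
pose P := gsum M N.
have [P0|/top_degree[i Pi Ptop]] := eqVneq (fullv : {vspace P}) 0%VS.
  have /eqP := dim_gsum M N; rewrite P0 dimv0 eq_sym addn_eq0 !dimv_eq0.
  by case/andP=> /eqP/K0class0-> /eqP/K0class0->.
have [k ek] : exists k, ch M (iota (e k)) i != 0%N.
  apply/existsP; apply: contraR Pi => /existsPn M0; rewrite -subv0.
  apply/subvP=> p pi; rewrite memv0 -(lm_act1E p) -(ghom1 iota) -e1 !linear_sum sum_lfunE.
  rewrite big1 // => k _; move: pi; rewrite [_ \in _]sum_degE => /andP[p1 p2].
  have cut0 (X : gmod A) (x : X) : ch X (iota (e k)) i = 0%N -> x \in gm_gr X i ->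
      lm_act X (iota (e k)) x = 0.
    move/eqP; rewrite dimv_eq0 => /eqP X0 xi; rewrite -(gproj_id xi) -cutE; apply/eqP.
    by rewrite -memv0 -X0 memv_img ?memvf.
  by rewrite [LHS]sum_actE !cut0 // -?chMN; have := M0 k; rewrite negbK => /eqP.
have [m [m0 mi em]] := cut_neq0 ek.
have [n [n0 ni en]] : exists n : N,
    [/\ n != 0, n \in gm_gr N i & lm_act N (iota (e k)) n = n].
  by apply: cut_neq0; rewrite -chMN.
have mt t : (lm_act M (iota t) m == 0) = (t * e k == 0).
  have := @e_annihilator (gres iota M) m k t m0.
  by rewrite /= !res_actE => /(_ em).
have nt t : (lm_act N (iota t) n == 0) = (t * e k == 0).
  have := @e_annihilator (gres iota N) n k t n0.
  by rewrite /= !res_actE => /(_ en).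
pose z : P := (m, n).
have zi : z \in gm_gr P i by rewrite [_ \in _]sum_degE mi ni.
have [Z [j [jh kj jE]]] := sub_gmodP (cyclic_gstable zi).
have jI : injective j by apply/lker0P/eqP.
have L : linear (fun a => lm_act P a z).
  by move=> c x y; rewrite linearP add_lfunE scale_lfunE.
(* On the top degree of M + N only T acts. *)
have Zi x : x \in gm_gr Z i -> exists t : T, j x = (lm_act M (iota t) m, lm_act N (iota t) n).
  move=> xi; have /memv_imgP[a _] : j x \in limg (linfun (fun a => lm_act P a z)).
    by rewrite -jE memv_img ?memvf.
  rewrite linfun_linE // => jxE; have [t tP] := act_top a; exists t.
  transitivity (lm_act P (iota t) z); last exact: sum_actE.
  rewrite -(tP P i z zi Ptop) -jxE gproj_id //.
  exact: (proj2 jh).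
pose f : 'Hom(Z, M) := (linfun (fun x : (M * N)%type => x.1 : M) \o j)%VF.
pose g : 'Hom(Z, N) := (linfun (fun x : (M * N)%type => x.2 : N) \o j)%VF.
have fE x : f x = (j x).1 by rewrite comp_lfunE linfun_linE.
have gE x : g x = (j x).2 by rewrite comp_lfunE linfun_linE.
have fh : gmod_hom f.
  split=> [a x|l x xl]; first by rewrite !fE (proj1 jh); rewrite [lm_act P a _]sum_actE.
  by have := proj2 jh _ _ xl; rewrite [_ \in _]sum_degE fE => /andP[].
have gh : gmod_hom g.
  split=> [a x|l x xl]; first by rewrite !gE (proj1 jh); rewrite [lm_act P a _]sum_actE.
  by have := proj2 jh _ _ xl; rewrite [_ \in _]sum_degE gE => /andP[].
clearbody f g.
have fi0 x : x \in gm_gr Z i -> f x = 0 -> x = 0.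
  case/Zi=> t jx; rewrite fE jx /= => /eqP; rewrite mt => te.
  apply: jI; rewrite jx linear0; congr (_, _); apply/eqP.
    by rewrite mt.
  by rewrite nt.
have gi0 x : x \in gm_gr Z i -> g x = 0 -> x = 0.
  case/Zi=> t jx; rewrite gE jx /= => /eqP; rewrite nt => te.
  apply: jI; rewrite jx linear0; congr (_, _); apply/eqP.
    by rewrite mt.
  by rewrite nt.
(* If the kernels spanned Z, the generator would have zero part in degree i. *)
have dKK : (\dim (lker f) + \dim (lker g) < \dim {:Z})%N.
  have fgI : (lker f :&: lker g = 0)%VS.
    apply/eqP; rewrite -subv0; apply/subvP=> x; rewrite memv_cap !memv_ker memv0.
    case/andP=> /eqP fx /eqP gx; apply/eqP/jI; rewrite linear0.
    by rewrite [j x]surjective_pairing -fE -gE fx gx.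
  rewrite -dimv_disjoint_sum // ltn_neqAle dimvS ?subvf // andbT.
  apply: contraNneq m0 => dE.
  have /vspaceP fgE : (lker f + lker g)%VS = fullv by apply/eqP; rewrite -dimv_leqif_eq ?dE ?subvf.
  have /memv_imgP[x _ zE] : z \in limg j.
    have := memv_img (linfun (fun a => lm_act P a z)) (memvf (1 : A)).
    by rewrite jE linfun_linE // lm_act1E.
  have xi : gproj (gm_gr Z) i x = x.
    by apply: jI; rewrite (gmod_hom_gproj _ _ jh) -zE gproj_id.
  have := fgE x; rewrite memvf => /memv_addP[y yf [w wg xE]].
  have y0 : gproj (gm_gr Z) i y = 0.
    apply: fi0; rewrite ?gproj_in //; apply/eqP; rewrite -memv_ker.
    exact: (proj2 (lker_gstable fh)).
  have w0 : gproj (gm_gr Z) i w = 0.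
    apply: gi0; rewrite ?gproj_in //; apply/eqP; rewrite -memv_ker.
    exact: (proj2 (lker_gstable gh)).
  have x0 : x = 0 by rewrite -xi xE linearD /= y0 w0 addr0.
  by move: zE; rewrite x0 linear0 => -[->].
have [Kf [C [CE dKf dC]]] := K0_ker_coker fh.
have [Kg [D [DE dKg dD]]] := K0_ker_coker gh.
have CD : K0eq (K0add (K0class C) (K0class Kg)) (K0add (K0class D) (K0class Kf)).
  rewrite -!K0gsum; apply: IHb => [|l d].
    rewrite !dim_gsum; move: dKf dC dKg dD dKK dMN; move: (\dim _) => *; lia.
  have idem : iota (e l) * iota (e l) = iota (e l) by rewrite -ghomM ee.
  have /= := K0ch_eq d (iota_deg0 _) idem CE; have /= := K0ch_eq d (iota_deg0 _) idem DE.
  have /= := K0ch_eq d (iota_deg0 _) idem (K0gsum C Kg).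
  have /= := K0ch_eq d (iota_deg0 _) idem (K0gsum D Kf).
  have := chMN l d; lia.
apply: (@K0add_cancel _ _ (K0add (K0class Kf) (K0class Kg))).
rewrite K0eq_addA -CE -K0eq_addA CD K0eq_addA DE -K0eq_addA.
by rewrite (K0eq_addC (K0class Kg)).
Qed.
End Grothendieck.

(** * Matrix units of a split semisimple algebra *)

(** [mu_e] are primitive orthogonal idempotents, [mu_r] chooses one idempotent in
    each isomorphism class of the modules T e_i, and [mu_u i], [mu_v i] are inverse
    isomorphisms, written as elements of e_i T e_{r(i)} and e_{r(i)} T e_i.
    [mu_span] is Schur's lemma in the split case, [mu_simple] the simplicity of T e_i. *)
Record matrix_units (K : fieldType) (T : falgType K) (I : finType) := MatrixUnits {
  mu_e : I -> T;
  mu_r : I -> I;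
  mu_u : I -> T;
  mu_v : I -> T;
  mu_neq0 : forall i, mu_e i != 0;
  mu_ee : forall i j, mu_e i * mu_e j = if i == j then mu_e i else 0;
  mu_e1 : \sum_i mu_e i = 1;
  mu_uv : forall i, mu_u i * mu_v i = mu_e i;
  mu_vu : forall i j, mu_v i * mu_u j = if i == j then mu_e (mu_r i) else 0;
  mu_span : forall i j t, exists c : K,
    mu_e i * t * mu_e j = if mu_r i == mu_r j then c *: (mu_u i * mu_v j) else 0;
  mu_simple : forall i t, t * mu_e i != 0 -> exists s, s * (t * mu_e i) = mu_e i }.

Section SemisimpleSplit.
Variables (K : fieldType) (T : galg K).
Hypothesis T0 : forall t : T, t \in ggr T 0.

Lemma regular_mod_actE (a t : T) : lm_act (regular_mod T) a t = a * t.
Proof. by rewrite /= !lfunE. Qed.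

Lemma gdeg0 i (t : T) : t \in ggr T i -> i != 0 -> t = 0.
Proof. by move=> ti i0; rewrite -(gproj_id ti) (gproj_dis i0). Qed.

(** A left ideal, as a module in its own right; T is concentrated in degree 0, so
    that the ideal is automatically graded. *)
Lemma ideal_gmodP (U : {vspace regular_mod T}) : simple_submod U ->
  exists N : gmod T, exists f : 'Hom(N, T),
  [/\ forall t n, f (lm_act N t n) = t * f n, lker f = 0%VS, limg f = U,
      forall n, n \in gm_gr N 0 & simple_mod N].
Proof.
case=> Us U0 Umin; have Ust : @gstable K T (gregular_mod T) U.
  split=> // i t tU; case: (eqVneq i 0) => [->|i0].
    by have -> : gproj (ggr T) 0 t = t by apply/gproj_id/T0.
  have -> : gproj (ggr T) i t = 0 by apply: gproj_dis (T0 t).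
  exact: mem0v.
have [N [f [[fh fg] kf fU]]] := sub_gmodP Ust.
have fI : injective f by apply/lker0P/eqP.
have fact t n : f (lm_act N t n) = t * f n by rewrite fh -regular_mod_actE.
exists N, f; split=> // [n|].
  apply: (gdeg_gproj (g := gm_gr N)) => j j0; apply: fI.
  by rewrite linear0; apply: gdeg0 (fg _ _ (gproj_in _ _ _)) j0.
split=> // [a m _||X Xs _]; first exact: memvf.
  by apply: contraNneq U0 => N0; rewrite -fU N0 limg0.
have [t x||X0|XU] := Umin (f @: X)%VS.
- by case/memv_imgP=> m mX ->; rewrite -fh memv_img ?Xs.
- by rewrite -fU limgS ?subvf.
- left; apply/eqP; rewrite -subv0; apply/subvP=> x xX; rewrite memv0; apply/eqP/fI.
  by rewrite linear0; apply/eqP; rewrite -memv0 -X0 memv_img.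
by right; apply/eqP; rewrite -(eq_limg_ker0 (f := f)) ?kf // XU fU.
Qed.

Section Units.
Variables (n : nat) (e : 'I_n -> T).
Hypothesis ee : forall i j, e i * e j = if i == j then e i else 0.
Hypothesis e1 : \sum_i e i = 1.
Hypothesis e0 : forall i, e i != 0.
Hypothesis e_simple : forall i t, t * e i != 0 -> exists s, s * (t * e i) = e i.
Hypothesis e_end : forall i t, exists c : K, e i * t * e i = c *: e i.

Let eid i : e i * e i = e i. Proof. by rewrite ee eqxx. Qed.

(** Schur's lemma: a nonzero element a of e_i T e_j has an inverse b by simplicity
    of T e_j; the product a b is idempotent, and it is the identity e_i since
    e_i T e_i is the line spanned by e_i. *)
Lemma units_inv i j t : e i * t * e j != 0 ->
  exists a b, [/\ e i * a = a, b * e i = b, a * b = e i & b * a = e j].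
Proof.
move=> t0; have [s sE] := e_simple t0.
set a := e i * t * e j in t0 sE; exists a, (e j * s * e i).
have ea : e i * a = a by rewrite /a !mulrA eid.
have ae : a * e j = a by rewrite /a -mulrA eid.
clearbody a; have ba : e j * s * e i * a = e j by rewrite -mulrA ea -mulrA sE eid.
split=> //; first by rewrite -mulrA eid.
have [c cE] := e_end i (a * (e j * s)).
have abE : a * (e j * s * e i) = c *: e i by rewrite -cE !mulrA ea.
have : c *: a = a by rewrite -{1}ea scalerAl -abE -[LHS]mulrA ba ae.
move/eqP; rewrite -subr_eq0 -{2}[a]scale1r -scalerBl scaler_eq0 (negPf t0) orbF.
by rewrite subr_eq0 => /eqP c1; rewrite abE c1 scale1r.
Qed.

(** The relation T e_i ~ T e_j, in boolean form so that representatives of its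
    classes can be picked. *)
Let linked i j := linfun (fun t => e i * t * e j) != 0 :> 'End(T).

Let sandwich_lin i j : linear (fun t => e i * t * e j).
Proof. by move=> k x y; rewrite mulrDr mulrDl -!scalerAr -scalerAl. Qed.

Lemma linkedP i j : reflect (exists t, e i * t * e j != 0) (linked i j).
Proof.
rewrite /linked; set f := linfun _; have fE t : f t = e i * t * e j.
  by rewrite linfun_linE.
apply: (iffP idP) => [f0|[t]]; last first.
  by rewrite -fE; apply: contraNneq => ->; rewrite zero_lfunE.
exists (vpick (lker f)^C%VS); rewrite -fE.
apply: contraNneq f0 => fp; have : vpick (lker f)^C%VS \in (lker f :&: (lker f)^C)%VS.
  by rewrite memv_cap memv_ker fp eqxx memv_pick.
rewrite capv_compl memv0 vpick0 => /eqP C0; apply/eqP/lfunP=> t.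
rewrite zero_lfunE; apply/eqP; rewrite -memv_ker.
by have := addv_complf (lker f); rewrite C0 addv0 => ->; rewrite memvf.
Qed.

Lemma linked_sym i j : linked i j -> linked j i.
Proof.
case/linkedP=> t /units_inv[a [b [ea be ab ba]]]; apply/linkedP; exists b.
apply: contraNneq (e0 j) => jbi.
have : e j * b * e i * a * e j = 0 by rewrite jbi !mul0r.
by rewrite -(mulrA _ (e i)) ea -[e j * b * a]mulrA ba !eid => ->.
Qed.

Lemma linked_trans i j k : linked i j -> linked j k -> linked i k.
Proof.
case/linkedP=> t /units_inv[a [b [ea be ab ba]]] /linkedP[t' t'0].
apply/linkedP; exists (a * (e j * t')); apply: contraNneq t'0 => it.
have : b * (e i * (a * (e j * t')) * e k) = 0 by rewrite it mulr0.
by rewrite !mulrA be ba eid => ->.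
Qed.

Lemma linked_refl i : linked i i.
Proof. by apply/linkedP; exists 1; rewrite mulr1 eid. Qed.

Let r i := odflt i [pick j | linked i j].

Lemma linked_r i : linked i (r i).
Proof. by rewrite /r; case: pickP => [j //|_]; apply: linked_refl. Qed.

Lemma linked_rE i j : linked i j = (r i == r j).
Proof.
apply/idP/eqP => [ij|rij]; last first.
  by apply: linked_trans (linked_r i) _; rewrite rij linked_sym // linked_r.
rewrite /r; have : linked i =1 linked j.
  by move=> k; apply/idP/idP => /(linked_trans _)-> //; exact: linked_sym.
by move=> /eq_pick->; case: pickP => // /(_ j); rewrite linked_refl.
Qed.

(** With u_i, v_i inverse to each other between i and its representative, an
    element t of e_i T e_j is u_i (v_i t u_j) v_j, and v_i t u_j is a scalar when
    i and j have the same representative. *)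
Lemma units_exist : exists mu : matrix_units T 'I_n, mu_e mu = e.
Proof.
have /fin_all_exists[u /fin_all_exists[v uvP]] i : exists a b,
    [/\ e i * a = a, b * e i = b, a * b = e i & b * a = e (r i)].
  by have /linkedP[t] := linked_r i; apply: units_inv.
have eu i : e i * u i = u i by case: (uvP i).
have ve i : v i * e i = v i by case: (uvP i).
have uv i : u i * v i = e i by case: (uvP i).
have vu i : v i * u i = e (r i) by case: (uvP i).
have VU i j : v i * u j = if i == j then e (r i) else 0.
  case: eqP => [<- //|/eqP ij].
  by rewrite -(ve i) -(eu j) mulrA -(mulrA (v i)) ee (negPf ij) mulr0 mul0r.
have span i j t : exists c : K,
    e i * t * e j = if r i == r j then c *: (u i * v j) else 0.
  case: eqP => [rij|/eqP]; last first.
    rewrite -linked_rE => /linkedP nl; exists 0.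
    by apply/eqP; case: eqVneq => // t0; case: nl; exists t.
  have [c cE] := e_end (r i) (v i * t * u j); exists c.
  have vrE : e (r i) * v i = v i by rewrite -vu -mulrA uv ve.
  have urE k : u k * e (r k) = u k by rewrite -vu mulrA uv eu.
  have : u i * (e (r i) * (v i * t * u j) * e (r i)) * v j = c *: (u i * v j).
    by rewrite cE -scalerAr urE -scalerAl.
  by rewrite !mulrA urE uv rij -!mulrA (mulrA (u j)) urE uv => ->; rewrite ?mulrA.
by exists (@MatrixUnits K T 'I_n e r u v e0 ee e1 uv VU span e_simple).
Qed.
End Units.

(** Decompose T into simple left ideals U_i and 1 into e_i in U_i.  For x in U_i
    the decomposition x = sum of the x e_j has to be the trivial one, so that the
    e_i are orthogonal idempotents with U_i = T e_i.  Right multiplication by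
    e_i t e_i is an endomorphism of U_i, hence a scalar. *)
Lemma semisimple_units : semisimple_alg T -> split_alg T ->
  exists n, inhabited (matrix_units T 'I_n).
Proof.
case=> s [sU sdir sfull] Tsplit; pose n := size s; exists n.
pose U (i : 'I_n) : {vspace T} := nth (0%VS : {vspace regular_mod T}) s i.
have Udir : directv (\sum_i U i).
  move: sdir; rewrite !directvE /= !(big_nth 0%VS) !big_mkord.
  exact.
have Ufull : (\sum_i U i)%VS = fullv.
  by rewrite -sfull (big_nth 0%VS) big_mkord.
have Us i : @simple_submod K T (regular_mod T) (U i) by apply/sU/mem_nth.
have U_ideal i t x : x \in U i -> t * x \in U i.
  by case: (Us i) => /(_ t x) + _ _ => /[apply]; rewrite regular_mod_actE.
have /memv_sumP[e eU e1] : 1 \in (\sum_i U i)%VS by rewrite Ufull memvf.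
have xe i x : x \in U i -> forall j, x * e j = if j == i then x else 0.
  move=> xU j; have /directv_sum_unique Uq := Udir.
  (* Two decompositions of x along the U_j: as the sum of the x e_j, and as x. *)
  have xeU k : true -> x * e k \in U k by rewrite U_ideal ?eU.
  have xU' k : true -> (if k == i then x else 0) \in U k.
    by case: eqP => [->|_]; rewrite ?mem0v.
  have := Uq _ _ xeU xU'; rewrite -mulr_sumr -e1 mulr1 -big_mkcond big_pred1_eq eqxx.
  by move/esym/forallP/(_ j)/eqP.
have ee i j : e i * e j = if i == j then e i else 0.
  by rewrite (xe i) ?eU // eq_sym.
have e0 i : e i != 0.
  have [_ U0 _] := Us i; apply: contraNneq U0 => ei0.
  rewrite -subv0; apply/subvP=> x xU; rewrite memv0.
  by have := xe i x xU i; rewrite eqxx ei0 mulr0 => <-.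
have e_simple i t : t * e i != 0 -> exists s, s * (t * e i) = e i.
  move=> te0; have [_ _ Umin] := Us i.
  have L : linear (fun s => s * (t * e i)) by move=> k x y; rewrite mulrDl scalerAl.
  pose f : 'End(T) := linfun (fun s => s * (t * e i)).
  have fE b : f b = b * (t * e i) by rewrite linfun_linE.
  clearbody f; have [a x /memv_imgP[b _ ->]||X0|XU] := Umin (limg f).
  - by rewrite regular_mod_actE fE mulrA -fE memv_img ?memvf.
  - by apply/subvP=> _ /memv_imgP[b _ ->]; rewrite fE !U_ideal ?eU.
  - case/eqP: te0; apply/eqP; rewrite -memv0 -[_ * _]mul1r -fE -X0.
    by rewrite memv_img ?memvf.
  have : e i \in limg f by rewrite XU eU.
  by case/memv_imgP=> b _; rewrite fE => bE; exists b.
have e_end i t : exists c : K, e i * t * e i = c *: e i.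
  have [N [f [fact kf fU _ Nsimple]]] := ideal_gmodP (Us i).
  set x := e i * t * e i; have xU : x \in U i by rewrite U_ideal ?eU.
  have fV y : y \in U i -> f ((f^-1)%VF y) = y by rewrite -fU => /limg_lfunVK.
  have fI : injective f by apply/lker0P/eqP.
  have fin m : f m \in U i by rewrite -fU memv_img ?memvf.
  (* Right multiplication by e_i t e_i, transported to N. *)
  pose phi : 'End(N) := (f^-1 \o linfun (fun y => y * x) \o f)%VF.
  have fphi m : f (phi m) = f m * x.
    rewrite !comp_lfunE linfun_linE; first by rewrite fV // U_ideal.
    by move=> k y z; rewrite mulrDl scalerAl.
  clearbody phi; have [|c cE] := Tsplit N Nsimple phi.
    by move=> a m; apply: fI; rewrite fact !fphi fact mulrA.
  exists c; have := fphi ((f^-1)%VF (e i)); rewrite cE scale_lfunE id_lfunE linearZ /=.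
  by rewrite fV ?eU // => ->; rewrite /x !mulrA ee eqxx.
by have [mu _] := units_exist ee (esym e1) e0 e_simple e_end.
Qed.
End SemisimpleSplit.

(** * Induction of a cyclic module *)

(** If V is generated by v, then the induced module is generated by 1 (x) v, and
    it is A modulo A f(ann v).  The operator [p] serves to describe this left
    ideal: [p_ann] and [p_ker] say that it is the kernel of [p], so that the
    induced module is identified with the image of [p]. *)
Section CyclicInduction.
Variables (K : fieldType) (S A : galg K) (f : ghom S A) (V : gmod S).
Variables (v : V) (d : int) (p : 'End(A)).
Hypothesis vd : v \in gm_gr V d.
Hypothesis v_gen : forall w : V, exists s, w = lm_act V s v.
Hypothesis p_ann : forall a s, lm_act V s v = 0 -> p (a * f s) = 0.
Hypothesis p_ker : forall a, p a = 0 -> ind_tens f a v = 0.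

Let theta : 'Hom(A, ind_space f V) := linfun (fun a => ind_tens f a v).

Let thetaE a : theta a = ind_tens f a v.
Proof. by rewrite linfun_linE // => k x y; rewrite /ind_tens tens_linl linearP. Qed.

(** The linear map induced by a (x) s v |-> p (a f(s)) is well defined by
    [p_ann]; it is evaluated at a (x) v to see that p a vanishes when a (x) v
    does. *)
Lemma ind_cyclic_ker : lker theta = lker p.
Proof.
(* sg is a linear choice of s with s v = w. *)
pose rho : 'Hom(S, V) := linfun (fun s => lm_act V s v).
have rhoE s : rho s = lm_act V s v.
  by rewrite linfun_linE // => k x y; rewrite linearP add_lfunE scale_lfunE.
have [sg sgE] : exists sg : 'Hom(V, S), forall w, lm_act V (sg w) v = w.
  exists (rho^-1)%VF => w; rewrite -rhoE limg_lfunVK //.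
  by have [s ->] := v_gen w; rewrite -rhoE memv_img ?memvf.
clearbody theta => {rho rhoE}.
pose b a (w : V) := p (a * f (sg w)).
have bl a : linear (b a) by move=> k x y; rewrite /b !linearP mulrDr -scalerAr linearP.
have br w : linear (b^~ w) by move=> k x y; rewrite /b mulrDl -scalerAl linearP.
have bE a w : tlift b (tens a w) = b a w by rewrite tliftE.
have pE a s w : p (a * f s * f (sg w)) = p (a * f (sg (lm_act V s w))).
  apply/eqP; rewrite -subr_eq0 -linearB -mulrA -mulrBr -ghomM -linearB; apply/eqP.
  by apply: p_ann; rewrite linearB /= add_lfunE opp_lfunE sgE -lm_actMM sgE subrr.
pose psi := qlift (limg (ind_rel f V)) (tlift b).
have psiE a : psi (theta a) = p a.
  rewrite thetaE /psi qliftE => [|_ /memv_imgP[x _ ->]].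
    rewrite bE /b -[in RHS](mulr1 a) -(ghom1 f).
    apply/eqP; rewrite -subr_eq0 -linearB -mulrBr -linearB; apply/eqP/p_ann.
    by rewrite linearB /= add_lfunE opp_lfunE sgE lm_act1E subrr.
  apply/eqP; rewrite -memv0 -comp_lfunE; apply: tensor_ind x => a' y.
  pose h := ((tlift b \o ind_rel f V) \o linfun (fun y : tensor S V => tens a' y))%VF.
  have hE z : h z = (tlift b \o ind_rel f V)%VF (tens a' z).
    by rewrite [LHS]comp_lfunE (linfun_linE (@tens_linr _ _ _ a')).
  rewrite -hE; apply: tensor_ind y => s w.
  by rewrite hE comp_lfunE ind_relE linearB /= !bE /b pE subrr mem0v.
apply/vspaceP=> a; rewrite !memv_ker -psiE; apply/eqP/eqP => [->|].
  by rewrite linear0.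
by rewrite psiE thetaE; apply: p_ker.
Qed.

Lemma ind_cyclic_surj : limg theta = fullv.
Proof.
apply/vspaceP=> q; rewrite memvf -(qprojK q); apply: tensor_ind (vsval q) => a w.
have [s ->] := v_gen w.
rewrite -[qproj _ _]/(ind_tens f a (lm_act V s v)) -ind_tens_balanced -thetaE.
by rewrite memv_img ?memvf.
Qed.

(** Both sides are the dimension of the image of x A_{j-d}, once under
    a |-> a (x) v and once under [p], and these two maps have the same kernel. *)
Lemma ch_ind_cyclic (x : A) j (y : 'End(A)) :
  (forall a, y a = p (x * gproj (ggr A) (j - d) a)) ->
  ch (gind f V) x j = \dim (limg y).
Proof.
move=> yE; pose X := limg (linfun (fun a => x * gproj (ggr A) (j - d) a)).
have XE a : linfun (fun a => x * gproj (ggr A) (j - d) a) a = x * gproj (ggr A) (j - d) a.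
  by rewrite linfun_linE // => k b c; rewrite linearP mulrDr scalerAr.
have -> : limg y = (p @: X)%VS.
  rewrite -limg_comp; congr (limg _); apply/lfunP=> a.
  by rewrite comp_lfunE XE yE.
have -> : \dim (p @: X) = \dim (theta @: X).
  apply/eqP; rewrite -(eqn_add2l (\dim (X :&: lker p))) limg_ker_dim.
  by rewrite -ind_cyclic_ker limg_ker_dim.
rewrite /ch -{1}ind_cyclic_surj -!limg_comp; congr (\dim (limg _)).
apply/lfunP=> a; rewrite ![in LHS]comp_lfunE [RHS]comp_lfunE XE !thetaE.
rewrite -[RHS](@ind_act_tens K S A f V x _ v); congr (_ _ _); rewrite -!thetaE.
rewrite (gproj_shift (gW := gm_gr (gind f V)) (d := d)) ?subrK // => i b bi.
by rewrite thetaE; apply: ind_tens_deg.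
Qed.
End CyclicInduction.

(** * Consequences of the triangular decomposition *)

(** Multiplications as linear maps, made opaque: an unfolding of [amulr] would
    also be rewritten by the composition lemmas. *)
Lemma mulr_lfun (K : fieldType) (A : falgType K) (c : A) :
  exists m : 'End(A), forall y, m y = y * c.
Proof. by exists (amulr c) => y; rewrite lfunE. Qed.

Lemma mull_lfun (K : fieldType) (A : falgType K) (c : A) :
  exists m : 'End(A), forall y, m y = c * y.
Proof. by exists (amull c) => y; rewrite lfunE. Qed.

Section GradingExtras.
Variable K : fieldType.

Lemma gproj_uniq (V : vectType K) (g : grading V) i (p : 'End(V)) :
  (forall j v, v \in g j -> p v = if i == j then v else 0) ->
  forall v, p v = gproj g i v.
Proof.
move=> pE v; apply/eqP; rewrite -subr_eq0 -memv0.
have -> : p v - gproj g i v = (p - gproj g i) v by rewrite add_lfunE opp_lfunE.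
apply: (graded_ind (g := g)) => j w wj.
by rewrite add_lfunE opp_lfunE (pE j w wj) (gproj_gdeg i wj) subrr mem0v.
Qed.

Variables (A : galg K).

Lemma prodv_ext (W : vectType K) (U V : {vspace A}) (f g : 'Hom(A, W)) :
  (forall u v, u \in U -> v \in V -> f (u * v) = g (u * v)) ->
  forall x, x \in (U * V)%VS -> f x = g x.
Proof.
move=> fg x xUV; apply/eqP; rewrite -subr_eq0 -opp_lfunE -add_lfunE -memv_ker.
apply: subvP x xUV; apply/prodvP=> u v uU vV.
by rewrite memv_ker add_lfunE opp_lfunE fg // subrr.
Qed.

Lemma prodv_gext (W : vectType K) (U V : gsub A) (f g : 'Hom(A, W)) :
  (forall i j u v, u \in U -> v \in V -> u \in ggr A i -> v \in ggr A j ->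
     f (u * v) = g (u * v)) ->
  forall x, x \in (U * V)%VS -> f x = g x.
Proof.
move=> fg; apply: prodv_ext => u v uU vV.
rewrite -(sum_gproj (ggr A) u) -(sum_gproj (ggr A) v) mulr_suml !linear_sum /=.
apply: eq_bigr => i _; rewrite mulr_sumr !linear_sum /=; apply: eq_bigr => j _.
by apply: (fg i j); rewrite ?gproj_in ?gsub_proj.
Qed.

Lemma mul0_gproj i (t a : A) :
  t \in ggr A 0 -> gproj (ggr A) i (t * a) = t * gproj (ggr A) i a.
Proof.
move=> t0; have [f fE] := mull_lfun t.
rewrite -!fE (gproj_shift (gW := ggr A) (d := 0)) ?addr0 // => j b bj.
by rewrite fE addrC; apply: ggrM.
Qed.

Lemma op_gproj i (a : gop A) : gproj (ggr (gop A)) i a = gproj (ggr A) (- i) a :> A.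
Proof.
pose p : 'End(gop A) := (to_op A \o gproj (ggr A) (- i) \o of_op A)%VF.
have pE b : p b = gproj (ggr A) (- i) b by rewrite !comp_lfunE to_opE of_opE.
have pU j b : b \in ggr (gop A) j -> p b = if i == j then b else 0.
  by rewrite [_ \in _]op_degE pE => /gproj_gdeg->; rewrite eqr_opp.
by rewrite -pE (gproj_uniq pU).
Qed.

Lemma dual_gproj (V : vectType K) (g : grading V) i (f : vdual V) :
  gproj (Grading (dual_is_grading g)) i f = (f \o gproj g i)%VF.
Proof.
pose p : 'End(vdual V) := linfun (fun f : vdual V => (f \o gproj g i)%VF : vdual V).
have pE h : p h = (h \o gproj g i)%VF by rewrite linfun_linE //; exact: dual_deg_lin.
rewrite -pE; apply/esym; apply: gproj_uniq => j h /dual_degP hE.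
apply/lfunP=> v; rewrite pE comp_lfunE hE comp_lfunE gprojK [j == i]eq_sym.
by case: eqP => [->|]; rewrite ?comp_lfunE // linear0 zero_lfunE.
Qed.
End GradingExtras.

(** In what follows [Bm] and [Bp] are the subalgebras B^- and B^+. *)
Section Triangular.
Variables (K : fieldType) (A : galg K) (D : tridec A).
Local Notation Am := (td_neg D).
Local Notation T := (td_zero D).
Local Notation Ap := (td_pos D).
Local Notation Bm := (Bneg D).
Local Notation Bp := (Bpos D).
Local Notation g := (gproj (ggr A)).

Lemma td_zero_deg0 t : t \in T -> t \in ggr A 0. Proof. exact: (subvP (td_zero_deg D)). Qed.

Lemma T_alg_deg0 (t : T_alg D) : t \in ggr (T_alg D) 0.
Proof. by rewrite [_ \in _]sub_degE; apply/td_zero_deg0/subvsP. Qed.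

Lemma Bpos_prod : (Bp : {vspace A}) = (T * Ap)%VS.
Proof. by rewrite /= (td_posC D). Qed.

Lemma sub_T_Bp t : t \in T -> t \in Bp.
Proof. exact: (subvP (sub_prod_gsub (td_zero_deg D) (td_posC D))). Qed.

Lemma sub_T_Bm t : t \in T -> t \in Bm.
Proof. exact: (subvP (sub_prod_gsub (td_zero_deg D) (td_negC D))). Qed.

Lemma Bpos_gproj_lt0 i b : i < 0 -> b \in Bp -> g i b = 0.
Proof. by move=> i0; apply: prod_gproj_eq0; exact: td_pos_deg. Qed.

Lemma Bneg_gproj_gt0 i b : 0 < i -> b \in Bm -> g i b = 0.
Proof. by move=> i0; apply: prod_gproj_eq0; exact: td_neg_deg. Qed.

Lemma Bpos_gproj0 b : b \in Bp -> g 0 b \in T.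
Proof. by apply: prod_gproj0; exact: td_pos0. Qed.

Lemma Bneg_gproj0 b : b \in Bm -> g 0 b \in T.
Proof. by apply: prod_gproj0; exact: td_neg0. Qed.

(** B^+ lives in nonnegative degrees, so taking the part of degree 0 is
    multiplicative on it. *)
Lemma Bpos_gproj0M b c : b \in Bp -> c \in Bp -> g 0 (b * c) = g 0 b * g 0 c.
Proof.
move=> bB cB; apply: gproj0_mul => i; case: (ltgtP i 0) => // i0 _.
  by left; apply: Bpos_gproj_lt0.
by right; apply: Bpos_gproj_lt0; rewrite ?oppr_lt0.
Qed.

Lemma Bneg_gproj0M b c : b \in Bm -> c \in Bm -> g 0 (b * c) = g 0 b * g 0 c.
Proof.
move=> bB cB; apply: gproj0_mul => i; case: (ltgtP i 0) => // i0 _.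
  by right; apply: Bneg_gproj_gt0; rewrite ?oppr_gt0.
by left; apply: Bneg_gproj_gt0.
Qed.

Lemma aspaceM (U : gsub A) a b : a \in U -> b \in U -> a * b \in U.
Proof. by move=> aU bU; apply: (subvP (asubv U)); rewrite memv_mul. Qed.

Let mulm := mul_map Am T Ap.

Lemma mul_mapE (u : sub_galg Am) (t : sub_galg T) (v : sub_galg Ap) :
  mulm (tens (tens u t) v) = vsval u * vsval t * vsval v.
Proof.
rewrite /mulm /mul_map tliftE => [|x k y z|w k y z]; last 2 first.
- by rewrite linearP mulrDr scalerAr.
- by rewrite linearP mulrDl scalerAl.
rewrite tliftE => [|x k y z|w k y z]; first by rewrite !sub_funE.
- by rewrite linearP mulrDr scalerAr.
by rewrite linearP mulrDl scalerAl.
Qed.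

Lemma tri_full : (Bm * Bp)%VS = fullv.
Proof.
apply/vspaceP=> a; rewrite memvf.
have [m' _ mK] := td_mul D; rewrite -(mK a); apply: tensor_ind (m' a) => x v.
pose c := linfun (fun x : tensor (sub_galg Am) (sub_galg T) => tens x v).
have cE y : c y = tens y v by rewrite linfun_linE //; apply: tens_linl.
rewrite -cE -comp_lfunE; apply: tensor_ind x => u t.
rewrite comp_lfunE cE mul_mapE memv_mul //.
  by rewrite /= memv_mul ?subvsP.
by rewrite Bpos_prod -[vsval v]mul1r memv_mul ?subvsP ?gsub1.
Qed.

Lemma tri_ext (W : vectType K) (f h : 'Hom(A, W)) :
  (forall i j x b, x \in Bm -> b \in Bp -> x \in ggr A i -> b \in ggr A j ->
     f (x * b) = h (x * b)) -> f =1 h.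
Proof. by move=> fh a; apply: (prodv_gext fh); rewrite tri_full memvf. Qed.

Let mulmV : 'Hom(A, tensor (tensor (sub_galg Am) (sub_galg T)) (sub_galg Ap)) := (mulm^-1)%VF.

Let mulmVE (u t v : A) : u \in Am -> t \in T -> v \in Ap ->
  mulmV (u * t * v) = tens (tens (vsproj Am u) (vsproj T t)) (vsproj Ap v).
Proof.
move=> uA tT vA; have kerm : lker mulm == 0%VS.
  by apply/lker0P; apply: bij_inj (td_mul D).
by rewrite -[RHS](lker0_lfunK kerm) mul_mapE !vsprojK.
Qed.

(** The inverse of the multiplication map composed with al (x) 1 (x) be. *)
Lemma tri_map (al be : 'End(A)) : exists p : 'End(A), forall u t v,
  u \in Am -> t \in T -> v \in Ap -> p (u * t * v) = al u * t * be v.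
Proof.
pose q := tlift (fun x (v : sub_galg Ap) =>
  tlift (fun (u : sub_galg Am) (t : sub_galg T) => al (vsval u) * vsval t) x * be (vsval v)).
exists (q \o mulmV)%VF => u t v uA tT vA; rewrite comp_lfunE mulmVE //.
rewrite /q tliftE => [|x k y z|w k y z]; last 2 first.
- by rewrite !linearP mulrDr scalerAr.
- by rewrite linearP mulrDl scalerAl.
rewrite tliftE ?vsprojK // => [x k y z|w k y z].
  by rewrite linearP mulrDr scalerAr.
by rewrite !linearP mulrDl scalerAl.
Qed.

(** The projection of A onto B^- that annihilates the elements of B^+ of positive
    degree. *)
Lemma tri_projneg : exists p : 'End(A),
  forall x b, x \in Bm -> b \in Bp -> p (x * b) = x * g 0 b.
Proof.
have [p pE] := tri_map \1%VF (g 0); exists p => x b xB.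
have pE' u s t v : u \in Am -> s \in T -> t \in T -> v \in Ap ->
    p (u * (s * t) * v) = u * s * g 0 (t * v).
  by move=> uA sT tT vA; rewrite pE ?aspaceM // id_lfunE mul0_gproj ?td_zero_deg0 // !mulrA.
have [m mE] := mull_lfun x; rewrite Bpos_prod -!mE -[LHS]comp_lfunE -[RHS]comp_lfunE => bB.
apply: prodv_ext bB => t v tT vA; rewrite !comp_lfunE !mE.
have [m1 m1E] := mulr_lfun (t * v); have [m2 m2E] := mulr_lfun (g 0 (t * v)).
rewrite -m1E -m2E -comp_lfunE; apply: prodv_ext xB => u s uA sT.
by rewrite comp_lfunE m1E m2E -pE' // !mulrA.
Qed.

(** The projection of A onto B^+ that annihilates the elements of B^- of negative
    degree. *)
Lemma tri_projpos : exists p : 'End(A),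
  forall x b, x \in Bm -> b \in Bp -> p (x * b) = g 0 x * b.
Proof.
have [p pE] := tri_map (g 0) \1%VF; exists p => x b xB.
have pE' u s t v : u \in Am -> s \in T -> t \in T -> v \in Ap ->
    p (u * (s * t) * v) = g 0 (u * s) * (t * v).
  by move=> uA sT tT vA; rewrite pE ?aspaceM // id_lfunE gproj_mul0 ?td_zero_deg0 // !mulrA.
have [m mE] := mull_lfun x; have [m' m'E] := mull_lfun (g 0 x).
rewrite Bpos_prod -mE -m'E -comp_lfunE => bB.
apply: prodv_ext bB => t v tT vA; rewrite comp_lfunE mE m'E.
have [m1 m1E] := mulr_lfun (t * v).
rewrite -!m1E -[LHS]comp_lfunE -[RHS]comp_lfunE; apply: prodv_ext xB => u s uA sT.
by rewrite !comp_lfunE !m1E -pE' // !mulrA.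
Qed.
End Triangular.

(** * Corner dimensions of B^- and B^+ *)

(** The operator whose image is the corner s M_d t. *)
Definition bicut (K : fieldType) (T : galg K) (M : gbimod T) (s : T) (d : int) (t : T) :
    'End(M) := (lm_act M s \o gb_ract M t \o gproj (gm_gr M) d)%VF.

Lemma bicutE (K : fieldType) (T : galg K) (M : gbimod T) s d t m :
  bicut M s d t m = lm_act M s (gb_ract M t (gproj (gm_gr M) d m)).
Proof. by rewrite !comp_lfunE. Qed.

Section CornerDimensions.
Variables (K : fieldType) (A : galg K) (D : tridec A).
Local Notation T := (td_zero D).
Local Notation Bm := (Bneg D).
Local Notation Bp := (Bpos D).
Local Notation g := (gproj (ggr A)).
Local Notation iota := (sub_incl T).

Lemma sub_gproj (U : gsub A) i (u : sub_galg U) :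
  vsval (gproj (ggr (sub_galg U)) i u) = g i (vsval u).
Proof.
rewrite -!sub_funE (gproj_shift (gW := ggr A) (d := 0)) ?addr0 // => j v vj.
by rewrite addr0; apply: sub_fun_gr.
Qed.

Lemma vsvalM (U : gsub A) (x y : sub_galg U) : vsval (x * y) = vsval x * vsval y.
Proof. by []. Qed.

Lemma vsval_incl (U V : gsub A) (UV : (U <= V)%VS) (u : sub_galg U) :
  vsval (sub_subincl UV u) = vsval u.
Proof. exact: subsub_funE. Qed.

Lemma gproj1 : g 0 1 = 1. Proof. by rewrite gproj_id ?ggr1. Qed.

Lemma tri_ext0 (W : vectType K) (f h : 'Hom(A, W)) :
  (forall x b, x \in Bm -> b \in Bp -> f (x * b) = h (x * b)) -> forall a, f a = h a.
Proof. by move=> fh; apply: (@tri_ext K A D) => i j x b xB bB _ _; apply: fh. Qed.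

Section Negative.
Variable p : 'End(A).
Hypothesis pE : forall x b, x \in Bm -> b \in Bp -> p (x * b) = x * g 0 b.

Lemma projneg_id x : x \in Bm -> p x = x.
Proof. by move=> xB; rewrite -{1}[x]mulr1 pE ?gsub1 // gproj1 mulr1. Qed.

Lemma projneg_in a : p a \in Bm.
Proof.
rewrite memv_preim; apply: subvP (memvf a); rewrite -(tri_full D).
apply/prodvP=> x b xB bB; rewrite -memv_preim pE // aspaceM //.
by apply/sub_T_Bm/Bpos_gproj0.
Qed.

Lemma projneg_mulr a b : b \in Bp -> p (a * b) = p a * g 0 b.
Proof.
move=> bB; have [m mE] := mulr_lfun b; have [m' m'E] := mulr_lfun (g 0 b).
rewrite -mE -m'E -!comp_lfunE; apply: tri_ext0 => x c xB cB {a}.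
by rewrite !comp_lfunE mE m'E -mulrA !pE ?aspaceM // (Bpos_gproj0M cB bB) mulrA.
Qed.

Lemma projneg_mull t a : t \in T -> p (t * a) = t * p a.
Proof.
move=> tT; have [m mE] := mull_lfun t; rewrite -!mE -!comp_lfunE.
apply: tri_ext0 => x c xB cB {a}; rewrite !comp_lfunE !mE mulrA !pE ?mulrA //.
by apply: aspaceM => //; apply: sub_T_Bm.
Qed.

Lemma projneg_gproj i a : p (g i a) = g i (p a).
Proof.
rewrite -!comp_lfunE; apply: (@tri_ext K A D) => j k x b xB bB xj bk {a}.
rewrite !comp_lfunE (gproj_gdeg i (ggrM xj bk)) pE // (gproj_gdeg 0 bk).
case: (eqVneq 0 k) bk => [<- b0|k0 bk]; last first.
  rewrite mulr0 linear0; case: ifP => _; last by rewrite linear0.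
  by rewrite pE // (gproj_dis k0 bk) mulr0.
rewrite (gproj_gdeg i (ggrM xj b0)); case: ifP => _; last by rewrite linear0.
by rewrite pE // (gproj_id b0).
Qed.

(** A is mapped by p onto B^-, compatibly with T and with the grading; so the
    corner of B^- is the image of an operator on A. *)
Lemma dim_bicut_Bneg (s t : T_alg D) d (y : 'End(A)) :
  (forall a, y a = p (iota s * g d a) * iota t) ->
  \dim (limg y) = \dim (limg (bicut (Bneg_bimod D) s d t)).
Proof.
move=> yE; pose h : 'Hom(sub_galg Bm, A) := linfun vsval.
have hE w : h w = vsval w by rewrite lfunE.
have hB (w : sub_galg Bm) : h (bicut (Bneg_bimod D) s d t w) = vsval s * g d (vsval w) * vsval t.
  by rewrite hE bicutE hom_lactE hom_ractE !vsvalM !vsval_incl -sub_gproj mulrA.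
have yE' a : y a = vsval s * g d (p a) * vsval t.
  by rewrite yE !sub_funE projneg_mull ?subvsP // projneg_gproj.
rewrite -(limg_dim_eq (f := h) (U := limg (bicut (Bneg_bimod D) s d t))); last first.
  have /eqP -> : lker h == 0%VS by apply/lker0P => u v; rewrite !hE => /val_inj.
  exact: capv0.
congr (\dim _); apply/vspaceP=> a; apply/idP/idP.
  case/memv_imgP=> b _ ->.
  rewrite yE' -(vsprojK (projneg_in b)) -hB.
  by do 2!apply: memv_img; rewrite memvf.
case/memv_imgP=> _ /memv_imgP[w _ ->] ->.
by rewrite hB -[vsval w]projneg_id ?subvsP // -yE' memv_img ?memvf.
Qed.

(** An element of positive degree of B^+ kills the top component, one of negative
    degree of B^- leads out of it.  So x b acts in the top degree as x_0 b_0,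
    which is the degree 0 part of p (x b). *)
Lemma act_topP (a : A) : exists t : T_alg D, forall (M : gmod A) i (m : M),
  m \in gm_gr M i -> (forall j, i < j -> gm_gr M j = 0%VS) ->
  gproj (gm_gr M) i (lm_act M a m) = lm_act M (iota t) m.
Proof.
have tT : g 0 (p a) \in T by rewrite Bneg_gproj0 ?projneg_in.
exists (vsproj T (g 0 (p a))) => M i m mi Mtop; rewrite sub_funE vsprojK // {tT}.
pose ev : 'Hom(A, M) := linfun (fun a => lm_act M a m).
have evE c : ev c = lm_act M c m.
  by rewrite linfun_linE // => k x y; rewrite linearP add_lfunE scale_lfunE.
rewrite -!evE -!comp_lfunE; apply: (@tri_ext K A D) => j k x b xB bB xj bk {a}.
rewrite !comp_lfunE !evE pE // (gproj_gdeg 0 bk).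
case: (eqVneq 0 k) bk => [<- b0|k0 bk]; last first.
  rewrite mulr0 !linear0 zero_lfunE -lm_actMM.
  case: (ltrgtP k 0) k0 => // k0 _.
    by rewrite -[b](gproj_id bk) (Bpos_gproj_lt0 k0 bB) linear0 zero_lfunE !linear0.
  have : lm_act M b m \in gm_gr M (k + i) by apply: gm_actP bk mi.
  by rewrite Mtop ?ltrDr // memv0 => /eqP->; rewrite !linear0.
have xbj := ggrM xj b0; rewrite (gproj_gdeg 0 xbj).
have := gm_actP xbj mi; rewrite addr0 => xbm.
rewrite (gproj_gdeg i xbm) -[X in X == _]add0r (inj_eq (addIr i)).
by case: ifP => // _; rewrite linear0 zero_lfunE.
Qed.
End Negative.

Section Positive.
Variable p : 'End(A).
Hypothesis pE : forall x b, x \in Bm -> b \in Bp -> p (x * b) = g 0 x * b.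

Lemma projpos_id b : b \in Bp -> p b = b.
Proof. by move=> bB; rewrite -{1}[b]mul1r pE ?gsub1 // gproj1 mul1r. Qed.

Lemma projpos_in a : p a \in Bp.
Proof.
rewrite memv_preim; apply: subvP (memvf a); rewrite -(tri_full D).
apply/prodvP=> x b xB bB; rewrite -memv_preim pE // aspaceM //.
by apply/sub_T_Bp/Bneg_gproj0.
Qed.

Lemma projpos_mull a x : x \in Bm -> p (x * a) = g 0 x * p a.
Proof.
move=> xB; have [m mE] := mull_lfun x; have [m' m'E] := mull_lfun (g 0 x).
rewrite -mE -m'E -!comp_lfunE; apply: tri_ext0 => y c yB cB {a}.
by rewrite !comp_lfunE mE m'E mulrA !pE ?aspaceM // (Bneg_gproj0M xB yB) mulrA.
Qed.

Lemma projpos_mulr t a : t \in T -> p (a * t) = p a * t.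
Proof.
move=> tT; have [m mE] := mulr_lfun t; rewrite -!mE -!comp_lfunE.
apply: tri_ext0 => x c xB cB {a}; rewrite !comp_lfunE !mE -mulrA !pE ?mulrA //.
by apply: aspaceM => //; apply: sub_T_Bp.
Qed.

Lemma projpos_gproj i a : p (g i a) = g i (p a).
Proof.
rewrite -!comp_lfunE; apply: (@tri_ext K A D) => j k x b xB bB xj bk {a}.
rewrite !comp_lfunE (gproj_gdeg i (ggrM xj bk)) pE // (gproj_gdeg 0 xj).
case: (eqVneq 0 j) xj => [<- x0|j0 xj]; last first.
  rewrite mul0r linear0; case: ifP => _; last by rewrite linear0.
  by rewrite pE // (gproj_dis j0 xj) mul0r.
rewrite (gproj_gdeg i (ggrM x0 bk)); case: ifP => _; last by rewrite linear0.
by rewrite pE // (gproj_id x0).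
Qed.

Lemma dim_bicut_Bpos (s t : T_alg D) d (y : 'End(A)) :
  (forall a, y a = iota s * p (g d a * iota t)) ->
  \dim (limg y) = \dim (limg (bicut (Bpos_bimod D) s d t)).
Proof.
move=> yE; pose h : 'Hom(sub_galg Bp, A) := linfun vsval.
have hE w : h w = vsval w by rewrite lfunE.
have hB (w : sub_galg Bp) : h (bicut (Bpos_bimod D) s d t w) = vsval s * g d (vsval w) * vsval t.
  by rewrite hE bicutE hom_lactE hom_ractE !vsvalM !vsval_incl -sub_gproj mulrA.
have yE' a : y a = vsval s * g d (p a) * vsval t.
  by rewrite yE !sub_funE projpos_mulr ?subvsP // projpos_gproj mulrA.
rewrite -(limg_dim_eq (f := h) (U := limg (bicut (Bpos_bimod D) s d t))); last first.
  have /eqP -> : lker h == 0%VS by apply/lker0P => u v; rewrite !hE => /val_inj.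
  exact: capv0.
congr (\dim _); apply/vspaceP=> a; apply/idP/idP.
  case/memv_imgP=> b _ ->.
  rewrite yE' -(vsprojK (projpos_in b)) -hB.
  by do 2!apply: memv_img; rewrite memvf.
case/memv_imgP=> _ /memv_imgP[w _ ->] ->.
by rewrite hB -[vsval w]projpos_id ?subvsP // -yE' memv_img ?memvf.
Qed.
End Positive.
End CornerDimensions.

(** * Generators of the simple graded modules of T *)
Section SimpleModules.
Variables (K : fieldType) (T : galg K) (I : finType) (mu : matrix_units T I).
Hypothesis T0 : forall t : T, t \in ggr T 0.
Local Notation e := (mu_e mu).

(** A simple graded module l is, through v, a shift by d of T e_k. *)
Definition simple_generator (l : gmod T) k d (v : l) : Prop :=
  [/\ v \in gm_gr l d, v != 0, lm_act l (e k) v = v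
    & forall w : l, exists t, w = lm_act l t v].

Lemma mu_ee1 k : e k * e k = e k. Proof. by rewrite mu_ee eqxx. Qed.

Lemma act_deg0 (l : gmod T) d t (v : l) : v \in gm_gr l d -> lm_act l t v \in gm_gr l d.
Proof. by move=> vd; rewrite -[d]add0r; apply: gm_actP. Qed.

Lemma mu_decomp (l : lmod T) (v : l) : v = \sum_k lm_act l (e k) v.
Proof. by rewrite -[LHS]lm_act1E -(mu_e1 mu) linear_sum sum_lfunE. Qed.

(** T has degree 0, so a homogeneous vector generates a graded submodule; take one
    of the form e_k w. *)
Lemma gsimple_generator (l : gmod T) : gsimple l ->
  exists k d (v : l), simple_generator k d v.
Proof.
case=> l0 lmin; have w0 : vpick (fullv : {vspace l}) != 0 by rewrite vpick0.
set w := vpick _ in w0.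
have [d d0] : exists d, gproj (gm_gr l) d w != 0.
  have /hasP[d _ d0] : has (fun d => gproj (gm_gr l) d w != 0) (gsupp (gm_gr l)).
    apply: contraR w0 => /hasPn w0; rewrite -(sum_gproj (gm_gr l) w) big_seq.
    by rewrite big1 // => d /w0; rewrite negbK => /eqP.
  by exists d.
have [k k0] : exists k, lm_act l (e k) (gproj (gm_gr l) d w) != 0.
  apply/existsP; apply: contraR d0 => /existsPn d0; rewrite (mu_decomp (gproj _ d w)).
  by rewrite big1 // => k _; apply/eqP; rewrite -[_ == _]negbK d0.
set v := lm_act l (e k) _ in k0; exists k, d, v.
have vd : v \in gm_gr l d by apply/act_deg0/gproj_in.
have L : linear (fun t => lm_act l t v) by move=> c x y; rewrite linearP add_lfunE scale_lfunE.
split=> //; first by rewrite lm_actMM mu_ee1.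
have [Us Ug] := cyclic_gstable vd.
have [U0|UE] := lmin _ Us Ug.
  case/eqP: k0; apply/eqP; rewrite -memv0 -U0 -[v]lm_act1E.
  have := memv_img (linfun (fun t => lm_act l t v)) (memvf (1 : T)).
  by rewrite linfun_linE // lm_act1E.
move=> u; have : u \in limg (linfun (fun t => lm_act l t v)) by rewrite UE memvf.
by case/memv_imgP=> t _ ->; exists t; rewrite linfun_linE.
Qed.

Lemma simple_generator_ann (l : gmod T) k d (v : l) t : simple_generator k d v ->
  (lm_act l t v == 0) = (t * e k == 0).
Proof. by case=> _ v0 ev _; apply: e_annihilator => //; exact: mu_simple. Qed.

Lemma mu_eu i : e i * mu_u mu i = mu_u mu i.
Proof.
rewrite -[RHS]mul1r -(mu_e1 mu) mulr_suml (bigD1 i) //= big1 ?addr0 // => j ji.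
by rewrite -mu_uv -mulrA mu_vu (negPf ji) mulr0.
Qed.

Lemma mu_ur i : mu_u mu i * e (mu_r mu i) = mu_u mu i.
Proof. by have := mu_vu mu i i; rewrite eqxx => <-; rewrite mulrA mu_uv mu_eu. Qed.

(** The right ideal e_k T is simple too: a nonzero component e_k t e_j is a
    multiple of u_k v_j, and u_j v_k multiplies it into a nonzero multiple of
    e_k. *)
Lemma mu_ann_left k t : (forall s, e k * t * s * e k = 0) -> e k * t = 0.
Proof.
move=> tk; rewrite -[LHS]mulr1 -(mu_e1 mu) mulr_sumr big1 // => j _.
have [c cE] := mu_span mu k j t; rewrite cE; case: eqP cE => // rkj cE.
have := tk (mu_u mu j * mu_v mu k); rewrite -(mu_eu j) !mulrA cE -!scalerAl.
rewrite -(mulrA _ (mu_v mu j)) mu_vu eqxx -rkj mu_ur mu_uv mu_ee1 => /eqP.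
rewrite scaler_eq0 => /orP[/eqP->|/eqP ek0]; first by rewrite scale0r.
by rewrite -mu_eu ek0 !mul0r scaler0.
Qed.

(** The dual of T e_k is e_k T as a right module.  Its generator f0 is the
    coordinate of e_k w on v; the other functionals are reached because the
    vectors u_j v_k v form a basis of l, dual to the functionals
    w |-> f0 (u_k v_j w). *)
Lemma dual_generator (l : gmod T) k d (v : l) : simple_generator k d v ->
  exists f0 : gdual l,
  [/\ f0 \in gm_gr (gdual l) d, (f0 \o lm_act l (e k))%VF = f0,
      forall f : gdual l, exists t, f = (f0 \o lm_act l t)%VF
    & forall t, (f0 \o lm_act l t)%VF = 0 -> e k * t = 0].
Proof.
move=> vgen; have [vd v0 ev vg] := vgen.
have ld w : w \in gm_gr l d by have [t ->] := vg w; apply: act_deg0.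
have vfree : free [tuple v] by rewrite seq1_free.
pose f0 : vdual l := linfun (fun w => coord [tuple v] 0 (lm_act l (e k) w) : K^o).
have ekw w : exists c : K, lm_act l (e k) w = c *: v.
  have [t ->] := vg w; have [c cE] := mu_span mu k k t.
  have eE : mu_u mu k * mu_v mu k = e k by rewrite mu_uv.
  exists c; rewrite -[in LHS]ev !lm_actMM cE eqxx eE linearZ /=.
  by rewrite scale_lfunE ev.
have f0E w : f0 w *: v = lm_act l (e k) w.
  rewrite /f0 linfun_linE; last by move=> c x y; rewrite !linearP.
  have [c cE] := ekw w; rewrite cE linearZ /=.
  by have := coord_free 0 0 vfree => /= ->; congr (_ *: _); apply: mulr1.
have scI (a b : K) : a *: v = b *: v -> a = b.
  move/eqP; rewrite -subr_eq0 -scalerBl scaler_eq0 (negPf v0) orbF.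
  by rewrite subr_eq0 => /eqP.
clearbody f0; exists f0; split.
- apply/dual_degE => j w jd wj.
  by rewrite -(gproj_id wj) (gproj_dis jd (ld w)) linear0.
- by apply/lfunP=> w; apply: scI; rewrite comp_lfunE !f0E lm_actMM mu_ee1.
(* The coordinates of f on the functionals w |-> f0 (u_k v_j w) are its values
   on the dual basis. *)
- move=> f; pose t := \sum_(j | mu_r mu j == mu_r mu k)
    (f (lm_act l (mu_u mu j * mu_v mu k) v) : K) *: (mu_u mu k * mu_v mu j).
  have tE m : mu_r mu m = mu_r mu k ->
      t * (mu_u mu m * mu_v mu k) = (f (lm_act l (mu_u mu m * mu_v mu k) v) : K) *: e k.
    move=> rmk; rewrite mulr_suml (bigD1 m) ?rmk //= big1 => [|j /andP[_ jm]]; last first.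
      by rewrite -scalerAl !mulrA -(mulrA _ (mu_v mu j)) mu_vu (negPf jm) mulr0 mul0r scaler0.
    rewrite addr0 -scalerAl !mulrA -(mulrA _ (mu_v mu m)) mu_vu eqxx rmk.
    by rewrite mu_ur mu_uv.
  clearbody t; exists t; apply/lfunP=> w; apply: scI.
  rewrite comp_lfunE f0E lm_actMM.
  have [s ->] := vg w; rewrite (mu_decomp (lm_act l s v)) !linear_sum scaler_suml /=.
  apply: eq_bigr => m _; have [c cE] := mu_span mu m k s.
  rewrite -[in lm_act l s v]ev !lm_actMM cE; case: eqP => [rmk|_]; last first.
    by rewrite mulr0 !linear0 zero_lfunE linear0 scale0r.
  rewrite -(mulrA (e k)) -scalerAr tE // -!scalerAr mu_ee1 scalerA !linearZ /= !scale_lfunE.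
  by rewrite ev linearZ.
move=> t t0; apply: mu_ann_left => s; apply/eqP.
have := simple_generator_ann (e k * t * s) vgen; rewrite -!lm_actMM -f0E.
by rewrite -[f0 _]comp_lfunE t0 zero_lfunE scale0r eqxx => <-.
Qed.
(** The simple module is T e_k itself, in degree 0. *)
Lemma simple_of_unit k : exists2 l : gmod T, gsimple l &
  exists v : l, simple_generator k 0 v.
Proof.
pose q : 'End(T) := linfun (fun t => t * e k).
have qE t : q t = t * e k.
  by rewrite linfun_linE // => c x y; rewrite mulrDl scalerAl.
have Us : @simple_submod K T (regular_mod T) (limg q).
  split=> [t _ /memv_imgP[s _ ->]||X Xs XU].
  - by rewrite regular_mod_actE qE mulrA -qE memv_img ?memvf.
  - apply: contraNneq (mu_neq0 mu k) => q0; rewrite -memv0 -q0 -(mu_ee1 k) -qE.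
    by rewrite memv_img ?memvf.
  have [X0|X0] := eqVneq X 0%VS; [by left|right].
  apply/eqP; rewrite eqEsubv XU /=; have pX := memv_pick X.
  have /memv_imgP[t _ tE] := subvP XU _ pX; rewrite qE in tE.
  have [|s sE] := @mu_simple _ _ _ mu k t; first by rewrite -tE vpick0.
  apply/subvP=> _ /memv_imgP[x _ ->]; rewrite qE -sE -tE mulrA -regular_mod_actE.
  exact: Xs.
have [N [f [fact kf fU N0 [_ Nn0 Nmin]]]] := ideal_gmodP T0 Us.
have fI : injective f by apply/lker0P/eqP.
exists N; first by split=> // X Xs _; apply: Nmin => //; exact: subvf.
have /memv_imgP[v _ vE] : e k \in limg f by rewrite fU -(mu_ee1 k) -qE memv_img ?memvf.
exists v; split=> [||| w]; first exact: N0.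
- by apply: contraNneq (mu_neq0 mu k) => v0; rewrite vE v0 linear0.
- by apply: fI; rewrite fact -vE mu_ee1.
have /memv_imgP[t _ tE] : f w \in limg q by rewrite -fU memv_img ?memvf.
by exists t; apply: fI; rewrite fact -vE -qE.
Qed.
End SimpleModules.

(** * Dimensions of the standard and costandard modules *)
Section Standard.
Variables (K : fieldType) (A : galg K) (D : tridec A).
Variables (I : finType) (mu : matrix_units (T_alg D) I).
Local Notation T := (td_zero D).
Local Notation Bm := (Bneg D).
Local Notation Bp := (Bpos D).
Local Notation g := (gproj (ggr A)).
Local Notation iota := (sub_incl T).
Local Notation e := (mu_e mu).

Variables (l : gmod (T_alg D)) (k : I) (d : int) (v : l).
Hypothesis vgen : simple_generator mu k d v.

Lemma quot_posE (b : sub_galg Bp) : vsval (quot_pos D b) = g 0 (vsval b).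
Proof.
exact: (prod_quot_funE (td_pos0 D)).
Qed.

Lemma quot_negE (b : sub_galg Bm) : vsval (quot_neg D b) = g 0 (vsval b).
Proof.
exact: (prod_quot_funE (td_neg0 D)).
Qed.

(** T is a section of the quotient map from B^+ to T. *)
Lemma T_lift_pos (t : T_alg D) : exists2 s : sub_galg Bp,
  vsval s = vsval t & quot_pos D s = t.
Proof.
have E : vsval (vsproj Bp (vsval t)) = vsval t by rewrite vsprojK //; apply/sub_T_Bp/subvsP.
exists (vsproj Bp (vsval t)) => //; apply: val_inj; rewrite [LHS]quot_posE.
by rewrite [in g 0 _]E gproj_id //; apply/(td_zero_deg0 (D := D))/subvsP.
Qed.

Lemma T_lift_neg (t : T_alg D) : exists2 s : sub_galg Bm,
  vsval s = vsval t & quot_neg D s = t.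
Proof.
have E : vsval (vsproj Bm (vsval t)) = vsval t by rewrite vsprojK //; apply/sub_T_Bm/subvsP.
exists (vsproj Bm (vsval t)) => //; apply: val_inj; rewrite [LHS]quot_negE.
by rewrite [in g 0 _]E gproj_id //; apply/(td_zero_deg0 (D := D))/subvsP.
Qed.

(** The module induced from l is A modulo the left ideal of the a with
    p(a) e_k = 0, where p is the projection onto B^-; that is, B^- e_k shifted
    by d. *)
Lemma ch_standard i j :
  ch (standard l) (iota (e i)) j = \dim (limg (bicut (Bneg_bimod D) (e i) (j - d) (e k))).
Proof.
have [p pE] := tri_projneg D; have [vd v0 ev vg] := vgen.
pose q : 'End(A) := linfun (fun a => p a * iota (e k)).
have qE a : q a = p a * iota (e k).
  by rewrite linfun_linE // => c x y; rewrite linearP mulrDl scalerAl.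
pose V := gres (quot_pos D) l; pose f := sub_incl Bp.
have VE s w : lm_act V s w = lm_act l (quot_pos D s) w.
  by rewrite [lm_act V s](res_actE (quot_pos D) l).
have vgV (w : V) : exists s, w = lm_act V s v.
  have [t wE] := vg w; have [s _ sE] := T_lift_pos t.
  by exists s; rewrite VE sE.
have q_ann a s : lm_act V s v = 0 -> q (a * f s) = 0.
  rewrite VE => /eqP; rewrite (simple_generator_ann _ vgen) => /eqP se.
  rewrite qE sub_funE (projneg_mulr pE) ?subvsP // -quot_posE -mulrA sub_funE.
  by rewrite -[vsval _ * vsval _]/(vsval (quot_pos D s * e k)) se mulr0.
pose th : 'Hom(A, ind_space f V) := linfun (fun a => ind_tens f a (v : V)).
have thE a : th a = ind_tens f a (v : V).
  by rewrite linfun_linE // => c x y; rewrite /ind_tens tens_linl linearP.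
have q_tens a : ind_tens f a (v : V) = ind_tens f (q a) (v : V).
  rewrite -!thE -[RHS]comp_lfunE; apply: (tri_ext0 (D := D)) => x b xB bB {a}.
  rewrite comp_lfunE qE pE // !thE -mulrA.
  have [s sb] : exists s : sub_galg Bp, b = f s.
    by exists (vsproj Bp b); rewrite sub_funE vsprojK.
  have [s' s'E s'q] := T_lift_pos (quot_pos D s * e k).
  have -> : g 0 b * iota (e k) = f s'.
    by rewrite sb !sub_funE -quot_posE s'E.
  rewrite sb !ind_tens_balanced; congr (ind_tens _ _ _).
  by rewrite !VE s'q -lm_actMM ev.
have q_ker a : q a = 0 -> ind_tens f a (v : V) = 0.
  by move=> qa; rewrite q_tens qa -thE linear0.
pose y : 'End(A) := linfun (fun a => q (iota (e i) * g (j - d) a)).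
have yE a : y a = q (iota (e i) * g (j - d) a).
  by rewrite linfun_linE // => c b b'; rewrite !linearP mulrDr -scalerAr linearP.
rewrite (@ch_ind_cyclic K (sub_galg Bp) A f V v d q vd vgV q_ann q_ker _ j y yE).
by apply: (dim_bicut_Bneg pE) => a; rewrite yE qE.
Qed.

Lemma op_mulE (B : falgType K) (a b : B^c) : a * b = (b : B) * (a : B). Proof. by []. Qed.

(** Up to duality this is the situation of the standard module in the opposite
    algebra, for the dual of l, which is generated in degree d; the degrees of the
    opposite algebra are opposite, whence d - j in place of j - d. *)
Lemma ch_costandard i j :
  ch (costandard l) (iota (e i)) j = \dim (limg (bicut (Bpos_bimod D) (e k) (d - j) (e i))).
Proof.
have [p pE] := tri_projpos D.
have [f0 [f0d ef0 f0g f0ann]] := dual_generator (@T_alg_deg0 _ _ D) vgen.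
pose V := gres (gop_hom (quot_neg D)) (gdual l); pose f := gop_hom (sub_incl Bm).
pose G := gind f V.
have VE (s : sub_galg Bm) (w : V) : lm_act V s w = (w \o lm_act l (quot_neg D s))%VF.
  rewrite [lm_act V s](res_actE (gop_hom (quot_neg D)) (gdual l)) [LHS]dual_actE.
  congr (_ \o _)%VF; congr (lm_act _ _); exact: (gop_funE (quot_neg D) s).
have fE (s : sub_galg Bm) : f s = vsval s :> A.
  by rewrite [LHS]gop_funE sub_funE.
(* The dual of the induced module has the same dimensions in each degree. *)
transitivity (ch G (iota (e i) : A^c) j).
  have e0 : iota (e i) \in ggr A 0 by apply: (ghom_gr iota); apply: T_alg_deg0.
  apply: dim_limg_dual => [w|h].
    apply: cut_idem; first by rewrite [_ \in _]op_degE oppr0.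
    by rewrite op_mulE -ghomM mu_ee1.
  rewrite [LHS](@cutE _ _ (costandard l)).
  rewrite [lm_act (costandard l) _](res_actE (gopop A) (gdual G)).
  rewrite [gopop A _]gopop_funE [LHS]dual_actE dual_gproj.
  rewrite -comp_lfunA; congr (_ \o _)%VF; apply/lfunP=> w; rewrite comp_lfunE cutE.
  rewrite (gproj_act (M := G) (d := 0) j) ?addr0 //.
  by rewrite [_ \in _]op_degE oppr0.
have [m mE] : exists m : 'End(A), forall a, m a = iota (e k) * p a.
  have [m mE] := mull_lfun (iota (e k)); exists (m \o p)%VF => a.
  by rewrite comp_lfunE mE.
pose q : 'End(A^c) := (to_op A \o m \o of_op A)%VF.
have qE (a : A) : q a = iota (e k) * p a :> A.
  by rewrite !comp_lfunE to_opE of_opE mE.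
clearbody q; have vgV (w : V) : exists s, w = lm_act V s f0.
  have [t wE] := f0g w; have [s _ sE] := T_lift_neg t.
  by exists s; rewrite VE sE.
have q_ann (a : A^c) s : lm_act V s f0 = 0 -> q (a * f s) = 0.
  rewrite VE => /f0ann es.
  rewrite op_mulE qE fE (projpos_mull pE) ?subvsP // -quot_negE mulrA sub_funE.
  by rewrite -[vsval _ * vsval _]/(vsval (e k * quot_neg D s)) es mul0r.
pose th : 'Hom(A, ind_space f V) := linfun (fun a : A => ind_tens f (a : A^c) (f0 : V)).
have thE (a : A) : th a = ind_tens f (a : A^c) (f0 : V).
  by rewrite linfun_linE // => c x y; rewrite /ind_tens [tens _ _]tens_linl linearP.
have q_tens (a : A) : ind_tens f (a : A^c) (f0 : V) = ind_tens f (q a) (f0 : V).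
  rewrite qE -!thE.
  rewrite -mE -[RHS]comp_lfunE; apply: (tri_ext0 (D := D)) => x b xB bB {a}.
  rewrite comp_lfunE mE pE // !thE mulrA.
  have [s sx] : exists s : sub_galg Bm, x = f s.
    by exists (vsproj Bm x); rewrite fE vsprojK.
  have [s' s'E s'q] := T_lift_neg (e k * quot_neg D s).
  have -> : iota (e k) * g 0 x = f s'.
    by rewrite sx !fE sub_funE -quot_negE s'E.
  rewrite sx -![_ * b]op_mulE !ind_tens_balanced; congr (ind_tens _ _ _).
  by rewrite !VE s'q lm_actM comp_lfunA ef0.
have q_ker (a : A^c) : q a = 0 -> ind_tens f a (f0 : V) = 0.
  by move=> qa; rewrite q_tens qa -thE linear0.
pose y : 'End(A) := linfun (fun a => iota (e k) * p (g (d - j) a * iota (e i))).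
have yE a : y a = iota (e k) * p (g (d - j) a * iota (e i)).
  by rewrite linfun_linE // => c b b'; rewrite linearP mulrDl -scalerAl linearP mulrDr -scalerAr.
rewrite -(dim_bicut_Bpos pE (y := y)) //.
rewrite (@ch_ind_cyclic K _ (gop A) f V f0 d q f0d vgV q_ann q_ker _ j
  (to_op A \o y \o of_op A)%VF).
  apply/esym/(dim_limg_transport (h := to_op A)) => [||a].
  - exact: linearP.
  - by exists (of_op A) => a; rewrite ?to_opE ?of_opE ?to_opE.
  by rewrite !comp_lfunE !to_opE of_opE.
move=> a; rewrite !comp_lfunE to_opE of_opE yE [RHS]qE op_mulE op_gproj opprB.
by [].
Qed.
End Standard.

(** * Graded bimodules are determined by their corners *)
Section Bimodules.
Variables (K : fieldType) (T : galg K).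
Hypothesis T0 : forall t : T, t \in ggr T 0.
Implicit Types M N : gbimod T.

Lemma lact_gproj M s d (m : M) :
  lm_act M s (gproj (gm_gr M) d m) = gproj (gm_gr M) d (lm_act M s m).
Proof. by rewrite (gproj_act _ _ (T0 s)) addr0. Qed.

Lemma ract_gproj M t d (m : M) :
  gb_ract M t (gproj (gm_gr M) d m) = gproj (gm_gr M) d (gb_ract M t m).
Proof.
rewrite (gproj_shift (gW := gm_gr M) (d := 0)) ?addr0 // => j v vj.
exact: gb_ractP (T0 t) vj.
Qed.

Lemma bicut_comp M s d t s' d' t' (m : M) :
  bicut M s d t (bicut M s' d' t' m) = if d == d' then bicut M (s * s') d (t' * t) m else 0.
Proof.
rewrite !bicutE -!lact_gproj -!ract_gproj gprojK.
case: eqP => [->|_]; last by rewrite !linear0.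
by rewrite gb_comm lm_actMM -[gb_ract M t (gb_ract M t' _)]comp_lfunE -gb_ractM.
Qed.

(** The operator s . t on the dual is the transpose of t . s, and the degree d of
    the dual is the degree - d of M. *)
Lemma dim_bicut_gbdual M s d t : s * s = s -> t * t = t ->
  \dim (limg (bicut (gbdual M) s d t)) = \dim (limg (bicut M t (- d) s)).
Proof.
move=> ss tt; apply: dim_limg_dual => [m|f]; first by rewrite bicut_comp eqxx ss tt.
have gE : gproj (gm_gr (gbdual M)) d f = (f \o gproj (gm_gr M) (- d))%VF.
  pose p : 'End(vdual M) := linfun (fun f : vdual M => (f \o gproj (gm_gr M) (- d))%VF : vdual M).
  have pE h : p h = (h \o gproj (gm_gr M) (- d))%VF by rewrite linfun_linE //; exact: dual_deg_lin.
  rewrite -pE; apply/esym; apply: gproj_uniq => j h /dual_degP hE.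
  apply/lfunP=> v; rewrite pE comp_lfunE hE comp_lfunE gprojK [in LHS]eq_sym eqr_opp [d == j]eq_sym.
  by case: eqP => [->|]; rewrite ?comp_lfunE // linear0 zero_lfunE.
rewrite [LHS](@bicutE _ _ (gbdual M)) gE [gb_ract _ _ _]bdual_ractE [lm_act _ _ _]bdual_lactE.
apply/lfunP=> m; rewrite !comp_lfunE /=; congr (f _).
by rewrite -lact_gproj -ract_gproj.
Qed.

Lemma dim_bicut_iso M N (f : 'Hom(M, N)) s d t :
  bijective f -> gmod_hom f ->
  (forall t m, f (gb_ract M t m) = gb_ract N t (f m)) ->
  \dim (limg (bicut M s d t)) = \dim (limg (bicut N s d t)).
Proof.
move=> fb fh fr; apply: (dim_limg_transport (h := f)) => // [|m]; first exact: linearP.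
by rewrite !bicutE (proj1 fh) fr (gmod_hom_gproj _ _ fh).
Qed.

Variables (I : finType) (mu : matrix_units T I).
Local Notation e := (mu_e mu).
Local Notation u := (mu_u mu).
Local Notation v := (mu_v mu).
Local Notation r := (mu_r mu).

(** T is spanned by the products u_i v_j with i and j in the same class. *)
Lemma lfun_units_eq (W : vectType K) (F G : 'Hom(T, W)) :
  (forall i j, r i = r j -> F (u i * v j) = G (u i * v j)) -> forall t, F t = G t.
Proof.
move=> FG t; rewrite -[t]mul1r -(mu_e1 mu) mulr_suml !linear_sum; apply: eq_bigr => i _.
rewrite -[_ * t]mulr1 -(mu_e1 mu) mulr_sumr !linear_sum; apply: eq_bigr => j _ /=.
have [c ->] := mu_span mu i j t; case: eqP => [rij|_]; last by rewrite !linear0.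
by rewrite !linearZ /= FG.
Qed.

(** The operators m |-> u_i m_d v_j and m |-> v_i m_d u_j, indexed by the triples
    (i, d, j), form a unit system on any graded bimodule, whose summands are the
    corners e_i M_d e_j.  The actions of u_i v_j on both sides and the
    projections on the components are sums of operators a_x b_y with x and y in
    the same class, so the glued isomorphism is one of graded bimodules. *)
Lemma gbimod_isoP M N :
  (forall i d j, \dim (limg (bicut M (e i) d (e j))) = \dim (limg (bicut N (e i) d (e j)))) ->
  gbimod_iso M N.
Proof.
move=> dMN; pose s := undup (gsupp (gm_gr M) ++ gsupp (gm_gr N)).
pose n := size s; pose deg (d : 'I_n) : int := nth 0 s d.
have degI : injective deg.
  by move=> a b /eqP; rewrite nth_uniq ?undup_uniq // => /eqP/val_inj.
have sum_deg (X : vectType K) (gX : grading X) : {subset gsupp gX <= s} ->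
    forall x, \sum_(d < n) gproj gX (deg d) x = x.
  move=> gs x; rewrite -[RHS](sum_gproj gX).
  transitivity (\sum_(d <- s) gproj gX d x); first by rewrite (big_nth 0) big_mkord.
  rewrite (bigID (mem (gsupp gX))) /= [X in _ + X]big1 ?addr0 => [|d gd]; last first.
    exact: gdeg_out gd (gproj_in _ _ _).
  rewrite -big_filter; apply/perm_big/uniq_perm.
  - by rewrite filter_uniq ?undup_uniq.
  - exact: gsupp_uniq.
  by move=> d; rewrite mem_filter; case gd: (d \in gsupp gX) => //=; rewrite gs.
pose rr (x : I * 'I_n * I) := (r x.1.1, x.1.2, r x.2).
pose a (X : gbimod T) (x : I * 'I_n * I) := bicut X (u x.1.1) (deg x.1.2) (v x.2).
pose b (X : gbimod T) (x : I * 'I_n * I) := bicut X (v x.1.1) (deg x.1.2) (u x.2).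
have aabE (X : gbimod T) (i i' : I) d (j j' : I) (m : X) :
    bicut X (u i) d (v j) (bicut X (v i') d (u j') m) =
    bicut X (u i * v i') d (u j' * v j) m by rewrite bicut_comp eqxx.
have suml (X : gbimod T) x d (m : X) :
    \sum_j bicut X x d (e j) m = lm_act X x (gproj (gm_gr X) d m).
  under eq_bigr => j _ do rewrite bicutE.
  rewrite -linear_sum; congr (lm_act X _ _).
  by rewrite -sum_lfunE -(linear_sum (gb_ract X)) /= (mu_e1 mu) gb_ract1 id_lfunE.
have sumr (X : gbimod T) x d (m : X) :
    \sum_i bicut X (e i) d x m = gb_ract X x (gproj (gm_gr X) d m).
  under eq_bigr => i _ do rewrite bicutE.
  by rewrite -sum_lfunE -(linear_sum (lm_act X)) /= (mu_e1 mu) lm_act1E.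
have sum_e (X : gbimod T) d (m : X) :
    \sum_i \sum_j bicut X (e i) d (e j) m = gproj (gm_gr X) d m.
  under eq_bigr => i _ do rewrite suml.
  by rewrite -sum_lfunE -(linear_sum (lm_act X)) /= (mu_e1 mu) lm_act1E.
have us (X : gbimod T) : {subset gsupp (gm_gr X) <= s} -> unit_system rr (a X) (b X).
  move=> Xs; split=> [[[i d] j] [[i' d'] j'] m|m].
    rewrite /a /b /= bicut_comp aabE !mu_vu !mu_uv (inj_eq degI) !xpair_eqE.
    rewrite [j' == j]eq_sym; case: (eqVneq d d') => [->|_]; last by rewrite andbF.
    case: (i == i') => /=; last by rewrite bicutE linear0 zero_lfunE.
    by case: (eqVneq j j') => [->|_] //; rewrite bicutE linear0 zero_lfunE linear0.
  rewrite -[RHS](sum_deg _ (gm_gr X) Xs).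
  rewrite -(pair_bigA _ (fun (x : I * 'I_n) j => a X (x, j) (b X (x, j) m))) /=.
  rewrite -(pair_bigA _ (fun i d => \sum_j a X (i, d, j) (b X (i, d, j) m))) /=.
  rewrite exchange_big /=; apply: eq_bigr => d _; rewrite -sum_e.
  by do 2!apply: eq_bigr => ? _; rewrite /a /b /= aabE !mu_uv.
have [|||f fb fE] := @glue_iso K _ rr M N (a M) (b M) (a N) (b N).
- by apply: us => d sd; rewrite mem_undup mem_cat sd.
- by apply: us => d sd; rewrite mem_undup mem_cat sd orbT.
- move=> [[i d] j]; have E (X : gbimod T) :
      (a X (i, d, j) \o b X (i, d, j))%VF = bicut X (e i) (deg d) (e j).
    by apply/lfunP=> m; rewrite comp_lfunE /a /b /= aabE !mu_uv.
  by rewrite !E.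
have fbicut i d j m : f (bicut M (e i) (deg d) (e j) m) = bicut N (e i) (deg d) (e j) (f m).
  by have := fE (i, d, j) (i, d, j) erefl m; rewrite /a /b /= !aabE !mu_uv.
have Ms : {subset gsupp (gm_gr M) <= s} by move=> d sd; rewrite mem_undup mem_cat sd.
have Ns : {subset gsupp (gm_gr N) <= s} by move=> d sd; rewrite mem_undup mem_cat sd orbT.
exists f; split=> //; first split=> [t m|d m md].
- pose F := (f \o linfun (fun t => lm_act M t m))%VF.
  pose G := linfun (fun t => lm_act N t (f m)).
  have FE x : F x = f (lm_act M x m).
    by rewrite comp_lfunE linfun_linE // => k y z; rewrite linearP add_lfunE scale_lfunE.
  have GE x : G x = lm_act N x (f m).
    by rewrite linfun_linE // => k y z; rewrite linearP add_lfunE scale_lfunE.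
  rewrite -FE -GE; apply: lfun_units_eq => i j rij; rewrite FE GE.
  rewrite -{1}(sum_deg _ _ Ms m) -(sum_deg _ _ Ns (f m)) !linear_sum; apply: eq_bigr => d _ /=.
  rewrite -!suml linear_sum; apply: eq_bigr => k _ /=; rewrite -!(mu_uv mu k) -!aabE.
  by apply: (fE (i, d, k) (j, d, k)); rewrite /rr /= rij.
- have [/(nthP 0)[o lto oE]|ds] := boolP (d \in s); last first.
    by rewrite (gdeg_out (contra (Ms d) ds) md) linear0 mem0v.
  suff -> : f m = gproj (gm_gr N) d (f m) by apply: gproj_in.
  rewrite -{1}(gproj_id md) -oE -[nth _ _ _]/(deg (Ordinal lto)) -!sum_e !linear_sum.
  by apply: eq_bigr => i _; rewrite linear_sum; apply: eq_bigr => j _; exact: fbicut.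
move=> t m.
pose F := (f \o linfun (fun t => gb_ract M t m))%VF.
pose G := linfun (fun t => gb_ract N t (f m)).
have FE x : F x = f (gb_ract M x m).
  by rewrite comp_lfunE linfun_linE // => k y z; rewrite linearP add_lfunE scale_lfunE.
have GE x : G x = gb_ract N x (f m).
  by rewrite linfun_linE // => k y z; rewrite linearP add_lfunE scale_lfunE.
rewrite -FE -GE; apply: lfun_units_eq => i j rij; rewrite FE GE.
rewrite -{1}(sum_deg _ _ Ms m) -(sum_deg _ _ Ns (f m)) !linear_sum; apply: eq_bigr => d _ /=.
rewrite -!sumr linear_sum; apply: eq_bigr => k _ /=; rewrite -!(mu_uv mu k) -!aabE.
by apply: (fE (k, d, j) (k, d, i)); rewrite /rr /= rij.
Qed.
End Bimodules.

Theorem proposition4p22 (K : fieldType) (A : galg K) (D : tridec A)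
    (Tss : semisimple_alg (T_alg D)) :
  BGG D <-> gbimod_iso (Bneg_bimod D) (gbdual (Bpos_bimod D)).
Proof.
have T0 : forall t : T_alg D, t \in ggr (T_alg D) 0 by exact: T_alg_deg0.
have [n [mu]] := semisimple_units T0 Tss (@td_split K A D).
have dual_dim i d j : \dim (limg (bicut (gbdual (Bpos_bimod D)) (mu_e mu i) d (mu_e mu j))) =
    \dim (limg (bicut (Bpos_bimod D) (mu_e mu j) (- d) (mu_e mu i))).
  by apply: (dim_bicut_gbdual T0); apply: mu_ee1.
split=> [bgg|[f [fb fh fr]] l /(gsimple_generator mu T0)[k [d [v vgen]]]].
  apply: (gbimod_isoP T0 (mu := mu)) => i d k; rewrite dual_dim.
  have [l lsimple [v vgen]] := simple_of_unit mu T0 k.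
  have idem : sub_incl (td_zero D) (mu_e mu i) * sub_incl (td_zero D) (mu_e mu i) =
      sub_incl (td_zero D) (mu_e mu i) by rewrite -ghomM mu_ee1.
  have := K0ch_eq d (ghom_gr _ (T0 _)) idem (bgg l lsimple) => /= -[].
  by rewrite (ch_standard vgen) (ch_costandard vgen) subr0 sub0r.
have [p pE] := tri_projneg D.
apply: (K0eq_ch T0 (mu_e1 mu) (mu_ee1 mu) (@mu_simple _ _ _ mu) (act_topP pE)) => i j.
rewrite (ch_standard vgen) (ch_costandard vgen) (dim_bicut_iso _ _ _ fb fh fr) dual_dim.
by rewrite opprB.
Qed.
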